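(* Let $A\in\mathbb{R}^{n\times n}$ be symmetric with eigenvalues $\lambda_1>\lambda_2\ge\cdots\ge\lambda_n$ and $\lambda_1>0$, let $v_1$ be a unit eigenvector of $A$ for $\lambda_1$, and let $f(x)=\|A-xx^\top\|_F^2$, with minimum value $f^*$ and set of minimizers $X^*=\{\pm\sqrt{\lambda_1}v_1\}$. Let the iteration follow SCD-Grad-LS($t$) with $k=1$, where $t\ge0$, and set $q=\frac{t+2}{t+1}$. Then for any $x^{(0)}\in D^+\cup D^-$ and every $\ell\ge0$, $$\mathbb{E}\left[f(x^{(\ell)})\mid x^{(0)}\right]-f^*\le\left(1-\frac{\mu_q}{L\,n^{2-\frac{2}{q}}}\right)^{\ell}\left(f(x^{(0)})-f^*\right).$$ Moreover, $$\mathbb{E}\left[\operatorname{dist}(x^{(\ell)},X^* )^2\mid x^{(0)}\right]\le\frac{2}{\mu_2}\left(1-\frac{\mu_q}{L\,n^{2-\frac{2}{q}}}\right)^{\ell}\left(f(x^{(0)})-f^*\right).$$ Here $L=12\lambda_1+2\min(2\lambda_1,\lambda_1-\lambda_2)+4\max_i|A_{i,i}|$, and $\mu_q>0$ and $\mu_2>0$ are constants such that $f$ is strongly $\|\cdot\|_q$-convex with constant $\mu_q$ and strongly $\|\cdot\|_2$-convex with constant $\mu_2$ on each of $B^+$ and $B^-$.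
   Context: $\|\cdot\|_F$ is the Frobenius norm, $\|\cdot\|$ the Euclidean norm, $\|\cdot\|_p$ the vector $p$-norm, $e_j$ the $j$-th standard basis vector, $\nabla_jf$ the $j$-th partial derivative, and $\operatorname{dist}(x,X^* )=\min_{y\in X^*}\|x-y\|$. Balls around the minimizers: $B^\pm=\left\{y:\|y\mp\sqrt{\lambda_1}v_1\|\le\frac{1}{30}\frac{\min(2\lambda_1,\lambda_1-\lambda_2)}{\sqrt{\lambda_1}}\right\}$. Sublevel sets: $D^\pm=\{x\in B^\pm: f(x)\le\min_{y\in\partial B^\pm}f(y)\}$, where $\partial B^\pm$ is the boundary of $B^\pm$. Strong $\|\cdot\|_p$-convexity ($p\ge1$): a continuously differentiable $g$ is strongly $\|\cdot\|_p$-convex on $S$ with constant $\mu_p>0$ if $g(y)\ge g(x)+\nabla g(x)^\top(y-x)+\frac{\mu_p}{2}\|y-x\|_p^2$ for all $x,y\in S$. For $f$ on $B^\pm$ one may take $\mu_2=3\min(2\lambda_1,\lambda_1-\lambda_2)$, and constants $\mu_p>0$ exist for all $p\ge1$. SCD-Grad-LS($t$) with $k=1$: given $x^{(\ell)}$, a single coordinate $j_\ell$ is sampled with $\Pr(j_\ell=j)$ proportional to $|\nabla_jf(x^{(\ell)})|^t$ (if these weights all vanish, the sampling distribution may be arbitrary), and then an exact line search is performed along that coordinate: $x^{(\ell+1)}=x^{(\ell)}+\alpha_\ell e_{j_\ell}$ with $\alpha_\ell\in\operatorname*{arg\,min}_{\alpha\in\mathbb{R}}f(x^{(\ell)}+\alpha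 e_{j_\ell})$. *)

(* Defs.v *)
From HB Require Import structures.
From mathcomp Require Import all_boot all_order all_algebra.
From mathcomp Require Import all_classical all_reals all_analysis.

Set Implicit Arguments.
Unset Strict Implicit.
Unset Printing Implicit Defensive.

Import Order.TTheory GRing.Theory Num.Theory numFieldNormedType.Exports.

Local Open Scope classical_set_scope.
Local Open Scope ring_scope.

(* The library norm `|x| on 'cV[R]_n is the sup norm, so the Euclidean norm and
   the p-norms are introduced separately; the topology is the same. *)
Definition enorm (R : realType) (n : nat) (x : 'cV[R]_n) : R :=
  Num.sqrt (\sum_i x i 0 ^+ 2).

Definition pnorm (R : realType) (n : nat) (p : R) (x : 'cV[R]_n) : R :=
  (\sum_i `|x i 0| `^ p) `^ p^-1.

Definition frobenius (R : realType) (m n : nat) (M : 'M[R]_(m, n)) : R :=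
  Num.sqrt (\sum_i \sum_j M i j ^+ 2).

Definition ebasis (R : realType) (n : nat) (j : 'I_n) : 'cV[R]_n :=
  delta_mx j 0.

Definition gradient (R : realType) (n : nat) (f : 'cV[R]_n -> R)
    (x : 'cV[R]_n) : 'cV[R]_n :=
  \col_j 'D_(ebasis R j) f x.

Definition objective (R : realType) (n : nat) (A : 'M[R]_n)
    (x : 'cV[R]_n) : R :=
  frobenius (A - x *m x^T) ^+ 2.

(* For the objective above the infimum is attained. *)
Definition min_value (R : realType) (n : nat) (f : 'cV[R]_n -> R) : R :=
  inf (range f).

Definition minimizers (R : realType) (n : nat) (f : 'cV[R]_n -> R) :
    set 'cV[R]_n :=
  [set x | forall y, f x <= f y].

Definition dist (R : realType) (n : nat) (x : 'cV[R]_n)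
    (S : set 'cV[R]_n) : R :=
  inf [set enorm (x - y) | y in S].

Definition boundary (T : topologicalType) (S : set T) : set T :=
  closure S `\` interior S.

Definition gap (R : realType) (l1 l2 : R) : R := Num.min (2 * l1) (l1 - l2).

(* B^+ is [min_ball l1 l2 v] and B^- is [min_ball l1 l2 (- v)]. *)
Definition min_ball (R : realType) (n : nat) (l1 l2 : R) (v : 'cV[R]_n) :
    set 'cV[R]_n :=
  [set y | enorm (y - Num.sqrt l1 *: v)
           <= 30^-1 * (gap l1 l2 / Num.sqrt l1)].

Definition boundary_sublevel (R : realType) (n : nat) (f : 'cV[R]_n -> R)
    (B : set 'cV[R]_n) : set 'cV[R]_n :=
  [set x | B x /\ f x <= inf (f @` boundary B)].

Definition strongly_convex (R : realType) (n : nat) (p mu : R)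
    (g : 'cV[R]_n -> R) (S : set 'cV[R]_n) : Prop :=
  [/\ 0 < mu,
      forall x, S x -> differentiable g x,
      {within S, continuous (gradient g)} &
      forall x y, S x -> S y ->
        g x + \sum_j gradient g x j 0 * (y - x) j 0
            + mu / 2 * pnorm p (y - x) ^+ 2 <= g y].

(* Since 0 `^ 0 = 1, all the weights are 1 when t = 0 (uniform sampling). *)
Definition coord_weight (R : realType) (n : nat) (t : R) (f : 'cV[R]_n -> R)
    (x : 'cV[R]_n) (j : 'I_n) : R :=
  `|gradient f x j 0| `^ t.

Definition coord_prob (R : realType) (n : nat) (t : R) (f : 'cV[R]_n -> R)
    (x : 'cV[R]_n) (j : 'I_n) : R :=
  coord_weight t f x j / \sum_i coord_weight t f x i.

(* The sigma-algebra generated by X_0, ..., X_l and J_0, ..., J_(l-1). *)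
Definition history (d : measure_display) (T : measurableType d) (R : realType)
    (n : nat) (X : nat -> T -> 'cV[R]_n) (J : nat -> T -> 'I_n) (l : nat) :
    set (set T) :=
  <<s [set E | (exists k i (B : set R),
                  [/\ (k <= l)%N, measurable B & E = [set w | B (X k w i 0)]])
               \/ (exists k j, (k < l)%N /\ E = [set w | J k w = j]) ] >>.

(* A run of SCD-Grad-LS(t) with k = 1.  [scd_sample] says that, wherever the
   weights at X_l do not all vanish, the conditional probability of J_l = j
   given the history is [coord_prob]; elsewhere the sampling is unconstrained,
   as is the choice among several exact line search minimizers. *)
Record scd_grad_ls (d : measure_display) (T : measurableType d) (R : realType)
    (P : probability T R) (n : nat) (t : R) (f : 'cV[R]_n -> R)
    (X : nat -> T -> 'cV[R]_n) (J : nat -> T -> 'I_n) : Prop := {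
  scd_measurable_iterate :
    forall l i, measurable_fun [set: T] (fun w => X l w i 0);
  scd_measurable_coord :
    forall l j, measurable [set w | J l w = j];
  scd_sample :
    forall l j (E : set T), history X J l E ->
      E `<=` [set w | exists i, coord_weight t f (X l w) i != 0] ->
      P (E `&` [set w | J l w = j])
      = (\int[P]_(w in E) (coord_prob t f (X l w) j)%:E)%E;
  scd_line_search :
    forall l w, exists2 a : R,
      (forall b : R, f (X l w + a *: ebasis R (J l w))
                     <= f (X l w + b *: ebasis R (J l w)))
      & X l.+1 w = X l w + a *: ebasis R (J l w)
}.

(* Main.v *)
Require Import Defs.
From HB Require Import structures.
From mathcomp Require Import all_boot all_order all_algebra.
From mathcomp Require Import all_classical all_reals all_analysis.
From mathcomp Require Import measurable_realfun.
From mathcomp Require Import ring lra.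
Set Implicit Arguments.
Unset Strict Implicit.
Unset Printing Implicit Defensive.
Import Order.TTheory GRing.Theory Num.Theory numFieldNormedType.Exports.
Local Open Scope classical_set_scope.
Local Open Scope ring_scope.

(** Put F = f - f^*. Completing the square gives
    F(x) = (|x|^2 - l1)^2 + 2 (l1 |x|^2 - x.Ax), where l1 is the largest
    eigenvalue; both terms are nonnegative by the Rayleigh bound
    x.Ax <= l1 |x|^2 ([rayleigh_le]).

    One step of the method is controlled by two opposite estimates. From above,
    f has coordinatewise second derivatives at most L on a neighbourhood of the
    balls B^+ and B^-, so an exact line search along e_j lowers f by at least
    (nabla_j f)^2 / (2 L) ([coordinate_descent]). From below, strong convexity
    in the q-norm and Hoelder's inequality, q and t + 2 being conjugate
    exponents, give the gradient dominance F <= |nabla f|_{t+2}^2 / (2 mu_q)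
    ([gradient_dominance]). Sampling with weights |nabla_j f|^t turns the mean
    of the squared partial derivatives into the quotient of the (t+2)-th by the
    t-th power sum, which is at least |nabla f|_{t+2}^2 / n^{2/(t+2)} by
    Hoelder's inequality again ([power_sum_ratio]); and 2/(t+2) = 2 - 2/q.
    Together these make the conditional mean of the decrease at least
    (1 - rate) F ([mean_decrease]).

    The estimates hold only near the minimizers, while an exact line search may
    jump far away, even from one ball to the other. It never leaves the union of
    D^+ and D^- because f exceeds the level min f on the boundary of the balls
    everywhere outside both of them ([above_level]): in the squares of the
    components of x along v1 and orthogonal to it, F is a convex quadratic, so
    it decreases along the straight path, in these squares, from x to the
    minimizer, and this path has to cross the boundary of the ball
    ([lower_sphere_point]). Hence the whole run stays in one deterministic set,
    on which F is bounded.

    The sampling rule is an identity between measures of events of the past; it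
    passes to integrals of functions of the past by approximation with simple
    functions ([integral_sample]). Integrating the one-step bound yields
    E F(x_{l+1}) <= rate E F(x_l), and iterating it the first claim. The second
    one follows from the first and F(x) >= mu_2/2 |x - x^*|^2, which is strong
    convexity at the minimizer x^*. *)

(** * The Euclidean inner product *)

Section DotProduct.
Context (R : realType) (n : nat).
Implicit Types (x y z v : 'cV[R]_n) (a : R) (A : 'M[R]_n).

Definition dotp x y : R := \sum_i x i 0 * y i 0.

Lemma dotpC x y : dotp x y = dotp y x.
Proof. by apply: eq_bigr => i _; rewrite mulrC. Qed.

Lemma dotpDl x y z : dotp (x + y) z = dotp x z + dotp y z.
Proof. by rewrite -big_split; apply: eq_bigr => i _; rewrite mxE mulrDl. Qed.

Lemma dotpDr x y z : dotp x (y + z) = dotp x y + dotp x z.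
Proof. by rewrite dotpC dotpDl !(dotpC x). Qed.

Lemma dotpZl a x y : dotp (a *: x) y = a * dotp x y.
Proof. by rewrite mulr_sumr; apply: eq_bigr => i _; rewrite mxE mulrA. Qed.

Lemma dotpZr a x y : dotp x (a *: y) = a * dotp x y.
Proof. by rewrite dotpC dotpZl dotpC. Qed.

Lemma dotpNl x y : dotp (- x) y = - dotp x y.
Proof. by rewrite -scaleN1r dotpZl mulN1r. Qed.

Lemma dotpNr x y : dotp x (- y) = - dotp x y.
Proof. by rewrite dotpC dotpNl dotpC. Qed.

Lemma dotp0 x : dotp x 0 = 0.
Proof. by rewrite -(scale0r 0) dotpZr mul0r. Qed.

Lemma dotp_ge0 x : 0 <= dotp x x.
Proof. by apply: sumr_ge0 => i _; rewrite -expr2 sqr_ge0. Qed.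

Lemma dotp_eq0 x : dotp x x = 0 -> x = 0.
Proof.
move=> /eqP; rewrite psumr_eq0 => [/allP xx0|i _]; last by rewrite -expr2 sqr_ge0.
apply/matrixP => i j; rewrite ord1 mxE.
by have /eqP := xx0 i (mem_index_enum i); move/eqP; rewrite -expr2 sqrf_eq0 => /eqP.
Qed.

Lemma dotp_ebasis x j : dotp x (ebasis R j) = x j 0.
Proof.
rewrite /dotp (bigD1 j)//= mxE !eqxx mulr1 big1 ?addr0// => i ij.
by rewrite mxE (negbTE ij) mulr0.
Qed.

Lemma dotp_mulmx A x y : dotp x (A *m y) = dotp (A^T *m x) y.
Proof.
rewrite /dotp; under eq_bigr do rewrite mxE mulr_sumr.
rewrite exchange_big; apply: eq_bigr => j _.
rewrite mxE mulr_suml; apply: eq_bigr => i _.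
by rewrite mxE; ring.
Qed.

Lemma enormE x : enorm x = Num.sqrt (dotp x x).
Proof. by rewrite /enorm /dotp; under eq_bigr do rewrite expr2. Qed.

Lemma enorm_sqr x : enorm x ^+ 2 = dotp x x.
Proof. by rewrite enormE sqr_sqrtr ?dotp_ge0. Qed.

Lemma enorm_ge0 x : 0 <= enorm x.
Proof. exact: sqrtr_ge0. Qed.

Lemma enorm_leP x a : 0 <= a -> (enorm x <= a) = (dotp x x <= a ^+ 2).
Proof.
by move=> a0; rewrite -enorm_sqr ler_sqr ?nnegrE ?enorm_ge0.
Qed.


(** Expanding |(x.x) y - (x.y) x|^2 >= 0 gives x.x times the claim. *)
Lemma cauchy_schwarz x y : dotp x y ^+ 2 <= dotp x x * dotp y y.
Proof.
have [x0|x0] := eqVneq (dotp x x) 0.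
  by rewrite (dotp_eq0 x0) dotpC !dotp0 mul0r expr0n.
have xgt0 : 0 < dotp x x by rewrite lt_def x0 dotp_ge0.
have := dotp_ge0 (dotp x x *: y - dotp x y *: x).
suff -> : dotp (dotp x x *: y - dotp x y *: x) (dotp x x *: y - dotp x y *: x)
    = dotp x x * (dotp x x * dotp y y - dotp x y ^+ 2).
  by rewrite pmulr_rge0// subr_ge0.
rewrite !(dotpDl, dotpDr, dotpNl, dotpNr, dotpZl, dotpZr) (dotpC y x).
ring.
Qed.

Lemma enormD x y : enorm (x + y) <= enorm x + enorm y.
Proof.
have xy0 := addr_ge0 (enorm_ge0 x) (enorm_ge0 y).
rewrite enorm_leP// sqrrD !enorm_sqr dotpDl !dotpDr (dotpC y x).
suff : dotp x y <= enorm x * enorm y by lra.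
apply: real_ler_normlW => //; first exact: num_real.
rewrite -ler_sqr ?nnegrE ?normr_ge0 ?mulr_ge0 ?enorm_ge0//.
by rewrite real_normK ?num_real// exprMn !enorm_sqr cauchy_schwarz.
Qed.

Lemma enormZ a x : enorm (a *: x) = `|a| * enorm x.
Proof. by rewrite !enormE dotpZl dotpZr mulrA -expr2 sqrtrM ?sqr_ge0// sqrtr_sqr. Qed.

Lemma enormN x : enorm (- x) = enorm x.
Proof. by rewrite -scaleN1r enormZ normrN1 mul1r. Qed.

Lemma enormB x y : enorm (x - y) = enorm (y - x).
Proof. by rewrite -opprB enormN. Qed.

Lemma enorm_ebasis j : enorm (ebasis R j : 'cV[R]_n) = 1.
Proof. by rewrite enormE dotp_ebasis mxE !eqxx sqrtr1. Qed.

End DotProduct.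

(** * The Rayleigh bound *)

Section Rayleigh.
Context (R : realType) (n : nat).
Implicit Types (x y z v : 'cV[R]_n) (a m : R) (A : 'M[R]_n).

Lemma continuous_sum (T : topologicalType) (I : Type) (r : seq I) (F : I -> T -> R) :
  (forall i, continuous (F i)) -> continuous (fun t => \sum_(i <- r) F i t).
Proof.
by move=> cF; apply: continuous_big; [exact: add_continuous|move=> i _; exact: cF].
Qed.

Lemma continuous_mul (T : topologicalType) (f g : T -> R) :
  continuous f -> continuous g -> continuous (fun t => f t * g t).
Proof. by move=> cf cg t; exact: cvgM (cf t) (cg t). Qed.

Lemma continuous_trmx_coord i : continuous (fun u : 'rV[R]_n => u^T i 0).
Proof.
have -> : (fun u : 'rV[R]_n => u^T i 0) = (fun u : 'rV[R]_n => u 0 i).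
  by apply/funext => u; rewrite mxE.
exact: coord_continuous.
Qed.

(** Compactness of the unit sphere gives the maximizer c, and homogeneity the
    inequality away from the sphere. The sphere is taken among row vectors,
    to which the Heine-Borel lemma applies. *)
Lemma max_on_sphere A x : x != 0 ->
  exists2 c, dotp c c = 1 & forall y, dotp y (A *m y) <= dotp c (A *m c) * dotp y y.
Proof.
move=> x0.
have norm_gt0 y : y != 0 -> 0 < dotp y y.
  move=> y0; rewrite lt_def dotp_ge0 andbT; apply: contra_neq y0; exact: dotp_eq0.
have normalize y : y != 0 -> dotp ((enorm y)^-1 *: y) ((enorm y)^-1 *: y) = 1.
  move=> /norm_gt0 y0; rewrite dotpZl dotpZr mulrA -invfM -expr2 enorm_sqr mulVf//.
  by rewrite gt_eqF.
pose S := [set u : 'rV[R]_n | dotp u^T u^T = 1].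
pose q (u : 'rV[R]_n) := dotp u^T (A *m u^T).
have cS : continuous (fun u : 'rV[R]_n => dotp u^T u^T).
  by apply: continuous_sum => i; apply: continuous_mul; exact: continuous_trmx_coord.
have cq : continuous q.
  have -> : q = fun u => \sum_i u^T i 0 * \sum_j A i j * u^T j 0.
    by apply/funext => u; apply: eq_bigr => i _; congr (_ * _); rewrite mxE.
  apply: continuous_sum => i; apply: continuous_mul.
    exact: continuous_trmx_coord.
  apply: continuous_sum => j; apply: continuous_mul; first exact: cst_continuous.
  exact: continuous_trmx_coord.
have S0 : S !=set0.
  by exists ((enorm x)^-1 *: x)^T; rewrite /S /= trmxK normalize.
have Scompact : compact S.
  apply: bounded_closed_compact.
    exists 1; split; first exact: num_real.
    move=> M M1 u Su /=; rewrite [leLHS]/Num.norm /= mx_normrE; apply/bigmax_leP.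
    split=> [|[i j] _ /=]; first by apply: le_trans (ltW M1); exact: ler01.
    apply: le_trans (ltW M1).
    rewrite -(@ler_pXn2r _ 2) ?nnegrE// real_normK ?num_real// expr1n -Su.
    rewrite ord1 /dotp (bigD1 j)//= !mxE -expr2 lerDl.
    by apply: sumr_ge0 => k _; rewrite -expr2 sqr_ge0.
  have -> : S = (fun u : 'rV[R]_n => dotp u^T u^T) @^-1` [set x | x = 1] by [].
  by apply: preimage_closed; [move=> u _; exact: cS|exact: closed_eq].
have [c cin cmax] := EVT_max_rV S0 Scompact (continuous_subspaceT cq).
exists c^T; first by move: cin; rewrite inE.
move=> y; have [->|y0] := eqVneq y 0; first by rewrite mulmx0 !dotp0 mulr0.
have := cmax ((enorm y)^-1 *: y)^T; rewrite inE /S /= trmxK normalize// => /(_ erefl).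
rewrite /q trmxK -scalemxAr dotpZl dotpZr mulrA -invfM -expr2 enorm_sqr.
by rewrite mulrC ler_pdivrMr ?norm_gt0.
Qed.

(** With m the maximal Rayleigh quotient, the form m |y|^2 - y.Ay is
    nonnegative and vanishes at c. Its first variation at c in the direction
    z = m c - A c is 2 |z|^2, which therefore has to be 0. *)
Lemma maximizer_eigenvector A c : A^T = A -> dotp c c = 1 ->
  (forall y, dotp y (A *m y) <= dotp c (A *m c) * dotp y y) ->
  A *m c = dotp c (A *m c) *: c.
Proof.
move=> Asym c1 cmax; set m := dotp c (A *m c) in cmax *.
have [z zE] : exists z, z = m *: c - A *m c by eexists.
pose Q := m * dotp z z - dotp z (A *m z).
have Q0 : 0 <= Q by rewrite subr_ge0.
have zc : m * dotp c z - dotp z (A *m c) = dotp z z.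
  by rewrite (dotpC c) -dotpZr -dotpNr -dotpDr -zE.
have cAz : dotp c (A *m z) = dotp z (A *m c) by rewrite dotp_mulmx Asym dotpC.
(* The step s has to be small against the second-order term Q; dividing by
   Q + 1 covers Q = 0 as well. *)
pose s := dotp z z / (Q + 1).
have := cmax (c - s *: z).
rewrite mulmxDr mulmxN -scalemxAr.
rewrite !(dotpDl, dotpDr, dotpNl, dotpNr, dotpZl, dotpZr) (dotpC z c) cAz c1 -/m.
have s0 : 0 <= s by rewrite divr_ge0 ?dotp_ge0// addr_ge0.
have Es : dotp z z = s * (Q + 1) by rewrite divfK// gt_eqF// ltr_wpDl.
move=> H; have {H} : 0 <= s ^+ 2 * Q - 2 * s * (m * dotp c z - dotp z (A *m c)).
  by rewrite /Q; move: H; lra.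
rewrite zc Es => H.
have : s ^+ 2 * (Q + 2) <= 0 by move: H; lra.
rewrite pmulr_lle0 ?ltr_wpDl// => s20.
have /eqP : s ^+ 2 == 0 by rewrite eq_le s20 sqr_ge0.
move/eqP; rewrite sqrf_eq0 => /eqP s00.
have /dotp_eq0/eqP : dotp z z = 0 by rewrite Es s00 mul0r.
by rewrite zE subr_eq0 => /eqP.
Qed.

(** The maximal Rayleigh quotient is an eigenvalue, hence a root of the
    characteristic polynomial, hence at most the head of the sorted list. *)
Lemma rayleigh_le A (lam : seq R) : A^T = A ->
  char_poly A = \prod_(a <- lam) ('X - a%:P) -> sorted >=%R lam ->
  forall x, dotp x (A *m x) <= lam`_0 * dotp x x.
Proof.
move=> Asym Alam lams x.
have [->|x0] := eqVneq x 0; first by rewrite mulmx0 !dotp0 mulr0.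
have [c c1 cmax] := max_on_sphere A x0.
have cE := maximizer_eigenvector Asym c1 cmax.
apply: le_trans (cmax x) _; apply: ler_wpM2r; first exact: dotp_ge0.
set m := dotp c (A *m c) in cE *.
have : eigenvalue A m.
  apply/eigenvalueP; exists c^T; first by rewrite -{1}Asym -trmx_mul cE linearZ.
  rewrite trmx_eq0; apply/eqP => c0; move: c1; rewrite c0 dotp0 => /esym/eqP.
  by rewrite oner_eq0.
rewrite eigenvalue_root_char Alam root_prod_XsubC.
case: lam lams {Alam} => [//|a s] /= /order_path_min; move=> /(_ _)/allP.
have tr : transitive (>=%R : rel R) by exact: ge_trans.
by move=> /(_ tr) H; rewrite inE => /predU1P[->//|/H].
Qed.

End Rayleigh.

(** * The objective and its gradient *)

Section Excess.
Context (R : realType) (n : nat) (A : 'M[R]_n) (l1 : R).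
Implicit Types (x y z v w : 'cV[R]_n).

(** This is f - f^* (see [excessE]), split into a term that controls the norm
    of x and a term that the Rayleigh bound makes nonnegative. *)
Definition excess x : R :=
  (dotp x x - l1) ^+ 2 + 2 * (l1 * dotp x x - dotp x (A *m x)).

Lemma objectiveE x :
  objective A x = (\sum_i \sum_j A i j ^+ 2 - l1 ^+ 2) + excess x.
Proof.
rewrite /objective /frobenius sqr_sqrtr; last first.
  by apply: sumr_ge0 => i _; apply: sumr_ge0 => j _; exact: sqr_ge0.
have xAx : dotp x (A *m x) = \sum_i \sum_j A i j * x i 0 * x j 0.
  rewrite /dotp; apply: eq_bigr => i _; rewrite mxE mulr_sumr.
  by apply: eq_bigr => j _; ring.
have xx2 : dotp x x ^+ 2 = \sum_i \sum_j (x i 0 * x j 0) ^+ 2.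
  rewrite expr2 /dotp mulr_suml; apply: eq_bigr => i _.
  by rewrite mulr_sumr; apply: eq_bigr => j _; ring.
have -> : excess x = dotp x x ^+ 2 - 2 * dotp x (A *m x) + l1 ^+ 2.
  by rewrite /excess; ring.
have E : \sum_i \sum_j (A - x *m x^T) i j ^+ 2 =
    \sum_i \sum_j A i j ^+ 2 - 2 * dotp x (A *m x) + dotp x x ^+ 2.
  rewrite xAx xx2 mulr_sumr -sumrB -big_split; apply: eq_bigr => i _ /=.
  rewrite mulr_sumr -sumrB -big_split; apply: eq_bigr => j _ /=.
  by rewrite !mxE big_ord1 mxE; ring.
by rewrite E; ring.
Qed.

(** On a coordinate line f is a quartic. The factor of a^2 is written with
    (2 x_j + a)^2 = (x_j + y_j)^2, where y is the endpoint: in this form it is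
    bounded by the norms of the two endpoints. *)
Lemma excess_step x j a : A^T = A ->
  excess (x + a *: ebasis R j) = excess x
    + a * (4 * (dotp x x * x j 0 - (A *m x) j 0))
    + a ^+ 2 * ((2 * x j 0 + a) ^+ 2 + 2 * dotp x x - 2 * A j j).
Proof.
move=> Asym; have eAe : (A *m ebasis R j) j 0 = A j j.
  by rewrite mxE (bigD1 j)//= mxE !eqxx mulr1 big1 ?addr0// => i ij;
     rewrite mxE (negbTE ij) mulr0.
have xAe : dotp x (A *m ebasis R j) = (A *m x) j 0.
  by rewrite dotp_mulmx Asym dotp_ebasis.
rewrite /excess mulmxDr -scalemxAr.
have ee : (ebasis R j : 'cV[R]_n) j 0 = 1 by rewrite mxE !eqxx.
rewrite !(dotpDl, dotpDr, dotpZl, dotpZr) xAe !(dotpC (ebasis R j)) !dotp_ebasis eAe ee.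
ring.
Qed.

Lemma excessN x : excess (- x) = excess x.
Proof. by rewrite /excess mulmxN !dotpNl !dotpNr !opprK. Qed.

End Excess.

Section Gradient.
Context (R : realType) (n : nat) (A : 'M[R]_n).
Implicit Types x : 'cV[R]_n.

Lemma objectiveN x : objective A (- x) = objective A x.
Proof. by rewrite !(objectiveE A 0) excessN. Qed.

(** By [excess_step] the difference quotient is a polynomial p in the step h,
    so that the derivative is p(0). *)
Lemma gradient_objective x j : A^T = A ->
  gradient (objective A) x j 0 = 4 * (dotp x x * x j 0 - (A *m x) j 0).
Proof.
move=> Asym; rewrite mxE /derive; set g := 4 * _.
apply: cvg_lim => //.
pose p (h : R) := g + h * ((2 * x j 0 + h) ^+ 2 + 2 * dotp x x - 2 * A j j).
have pg : p h @[h --> 0^'] --> g.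
  have p0 : p 0 = g by rewrite /p mul0r addr0.
  rewrite -p0; apply: cvg_within_filter; rewrite /p.
  apply: cvgD; first exact: cvg_cst.
  apply: cvgM; first exact: cvg_id.
  apply: cvgB; last exact: cvg_cst.
  apply: cvgD; last exact: cvg_cst.
  by rewrite expr2; apply: cvgM; apply: cvgD; (try exact: cvg_cst); exact: cvg_id.
apply: cvg_trans pg; apply: near_eq_cvg; near=> h.
have h0 : h != 0 by near: h; exact: nbhs_dnbhs_neq.
rewrite /= [h *: _ + x]addrC !(objectiveE A 0) excess_step// -/g /p /GRing.scale/=.
by field.
Unshelve. all: by end_near. Qed.

End Gradient.

Section Minimum.
Context (R : realType) (n : nat) (A : 'M[R]_n) (l1 : R).
Hypothesis Asym : A^T = A.
Implicit Types x y : 'cV[R]_n.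
Local Notation excess := (excess A l1).

Hypothesis rayleigh : forall x, dotp x (A *m x) <= l1 * dotp x x.

Lemma excess_ge0 x : 0 <= excess x.
Proof. by rewrite addr_ge0 ?sqr_ge0// mulr_ge0// subr_ge0. Qed.

Hypothesis l1_gt0 : 0 < l1.
Context (v : 'cV[R]_n).
Hypotheses (Av : A *m v = l1 *: v) (v1 : enorm v = 1).

Lemma dotp_unit : dotp v v = 1.
Proof. by rewrite -enorm_sqr v1 expr1n. Qed.

Lemma excess_minimizer : excess (Num.sqrt l1 *: v) = 0.
Proof.
rewrite /excess -scalemxAr Av !(dotpZl, dotpZr) dotp_unit !mulr1.
rewrite mulrA -expr2 sqr_sqrtr ?ltW//; ring.
Qed.

Lemma min_value_objective :
  min_value (objective A) = \sum_i \sum_j A i j ^+ 2 - l1 ^+ 2.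
Proof.
set K := RHS; have lbK : lbound (range (objective A)) K.
  by move=> _ [x _ <-]; rewrite (objectiveE A l1) lerDl excess_ge0.
apply/eqP; rewrite eq_le; apply/andP; split; last first.
  by apply: lb_le_inf => //; exists (objective A 0), 0.
apply: ge_inf; first by exists K.
by exists (Num.sqrt l1 *: v) => //; rewrite (objectiveE A l1) excess_minimizer addr0.
Qed.

Lemma excessE x : objective A x - min_value (objective A) = excess x.
Proof. by rewrite min_value_objective (objectiveE A l1) [_ + excess x]addrC addrK. Qed.

Lemma minimizer_in : minimizers (objective A) (Num.sqrt l1 *: v).
Proof. by move=> y; rewrite !(objectiveE A l1) lerD2l excess_minimizer excess_ge0. Qed.

Lemma gradient_minimizer j : gradient (objective A) (Num.sqrt l1 *: v) j 0 = 0.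
Proof.
rewrite gradient_objective// -scalemxAr Av !(dotpZl, dotpZr) dotp_unit !mxE mulr1.
by rewrite -expr2 sqr_sqrtr ?ltW//; ring.
Qed.

End Minimum.

(** * Balls around the minimizers *)

Section Balls.
Context (R : realType) (n : nat).
Implicit Types (x y z v w p : 'cV[R]_n) (r : R).

Lemma continuous_enorm_sub p : continuous (fun y => enorm (y - p)).
Proof.
have -> : (fun y => enorm (y - p)) =
    Num.sqrt \o (fun y => \sum_i (y i 0 - p i 0) * (y i 0 - p i 0)).
  apply/funext => y /=; rewrite enormE /dotp; congr Num.sqrt.
  by apply: eq_bigr => i _; rewrite !mxE.
move=> y; apply: continuous_comp; last exact: sqrt_continuous.
move: y; apply: continuous_sum => i.
have c : continuous (fun y : 'cV[R]_n => y i 0 - p i 0).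
  have cc : continuous (fun y : 'cV[R]_n => y i 0) by exact: coord_continuous.
  by move=> y; exact: cvgB (cc y) (cvg_cst _).
exact: continuous_mul.
Qed.

Lemma boundary_ball p r : 0 < r ->
  boundary [set y | enorm (y - p) <= r] = [set y | enorm (y - p) = r].
Proof.
move=> r0; set B := [set y | _].
have clB : closed B.
  apply: (@preimage_closed _ _ (fun y => enorm (y - p)) [set t | t <= r]).
    by move=> y _; exact: continuous_enorm_sub.
  exact: closed_le.
rewrite /boundary -(closure_id _).1//; apply/seteqP; split=> y /=.
  move=> [yr yi]; apply/eqP; rewrite eq_le yr /= leNgt; apply/negP => yr'.
  apply: yi; apply: (@filterS _ _ _ [set y | enorm (y - p) < r]).
    by move=> z /=; exact: ltW.
  apply: open_nbhs_nbhs; split=> //.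
  apply: (@open_comp _ _ (fun y => enorm (y - p)) [set t | t < r]).
    by move=> z _; exact: continuous_enorm_sub.
  exact: open_lt.
move=> yr; split; first by rewrite /B/= yr.
move=> yi.
have : (y + s *: (y - p)) @[s --> (0:R)] --> y.
  rewrite -[X in _ --> X]addr0; apply: cvgD; first exact: cvg_cst.
  rewrite -[X in _ --> X](scale0r (y - p)).
  by apply: cvgZ; [exact: cvg_id|exact: cvg_cst].
move=> /(_ _ yi) /nbhs_ballP [e /= e0 eB].
(* A point of the sphere moved outwards by the factor 1 + e/2 leaves the ball. *)
have : ball (0:R) e (e / 2).
  by rewrite /ball/= sub0r normrN gtr0_norm ?divr_gt0// ltr_pdivrMr//; lra.
move/eB; rewrite /B/=.
have -> : y + e / 2 *: (y - p) - p = (1 + e / 2) *: (y - p).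
  by rewrite scalerDl scale1r addrAC.
rewrite enormZ yr gtr0_norm; last by rewrite addr_gt0// divr_gt0.
rewrite mulrDl mul1r gerDl leNgt => /negP; apply.
by rewrite mulr_gt0// divr_gt0.
Qed.

Lemma pnorm2 x : pnorm 2 x = enorm x.
Proof.
rewrite /pnorm powR12_sqrt; last by apply: sumr_ge0 => i _; exact: powR_ge0.
rewrite /enorm; congr Num.sqrt; apply: eq_bigr => i _.
by rewrite powR_mulrn ?normr_ge0// real_normK ?num_real.
Qed.

End Balls.

Section Basin.
Context (R : realType) (n : nat) (A : 'M[R]_n) (l1 l2 : R).
Hypothesis Asym : A^T = A.
Hypothesis rayleigh : forall x, dotp x (A *m x) <= l1 * dotp x x.
Hypotheses (l1_gt0 : 0 < l1) (l2_lt : l2 < l1).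
Implicit Types (x y z v w : 'cV[R]_n).

(** The radius of B^+ and B^-. It is small against sqrt l1 ([ball_radius_le]),
    which keeps the two balls far apart. *)
Definition ball_radius : R := 30^-1 * (gap l1 l2 / Num.sqrt l1).
Local Notation r := ball_radius.
Local Notation f := (objective A).
Local Notation F := (excess A l1).

Lemma sqrt_l1_gt0 : 0 < Num.sqrt l1. Proof. by rewrite sqrtr_gt0. Qed.

Lemma gap_gt0 : 0 < gap l1 l2.
Proof. by rewrite /gap lt_min mulr_gt0// subr_gt0. Qed.

Lemma ball_radius_gt0 : 0 < r.
Proof. by rewrite mulr_gt0 ?invr_gt0// divr_gt0 ?gap_gt0 ?sqrt_l1_gt0. Qed.

Lemma gap_radius : gap l1 l2 = 30 * Num.sqrt l1 * r.
Proof.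
rewrite /r; have := sqrt_l1_gt0; move: (Num.sqrt l1) => s s0.
by field; rewrite gt_eqF.
Qed.

Lemma ball_radius_le : 15 * r <= Num.sqrt l1.
Proof.
have : gap l1 l2 <= 2 * (Num.sqrt l1 ^+ 2).
  by rewrite sqr_sqrtr; [rewrite /gap ge_min lexx|exact: ltW].
rewrite gap_radius expr2 => H; have := sqrt_l1_gt0 => s0.
have : Num.sqrt l1 * (15 * r) <= Num.sqrt l1 * Num.sqrt l1 by lra.
by rewrite ler_pM2l.
Qed.

Section OneBall.
Context (v : 'cV[R]_n).
Hypotheses (Av : A *m v = l1 *: v) (v1 : enorm v = 1).
Context (mu2 : R).
Hypothesis sc2 : strongly_convex 2 mu2 f (min_ball l1 l2 v).

Let p := Num.sqrt l1 *: v.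

Lemma minimizer_in_ball : min_ball l1 l2 v p.
Proof.
by rewrite /min_ball /= subrr enormE dotp0 sqrtr0 ltW// ball_radius_gt0.
Qed.

(** Strong convexity at the minimizer p, where the gradient vanishes. *)
Lemma quadratic_growth y : min_ball l1 l2 v y ->
  mu2 / 2 * enorm (y - p) ^+ 2 <= F y.
Proof.
move=> By; have [_ _ _ /(_ p y minimizer_in_ball By)] := sc2.
rewrite pnorm2 big1 ?addr0 => [|j _]; last first.
  by rewrite /p (gradient_minimizer Asym)// mul0r.
by rewrite !(objectiveE A l1) /p excess_minimizer// !addr0 lerD2l.
Qed.

Lemma excess_sphere_gt0 y : enorm (y - p) = r -> 0 < F y.
Proof.
move=> yr; have mu20 : 0 < mu2 by case: sc2.
apply: lt_le_trans (quadratic_growth _); last by rewrite /min_ball /= yr lexx.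
by rewrite yr mulr_gt0 ?divr_gt0// exprn_gt0// ball_radius_gt0.
Qed.

(** Write x = a v + w with w orthogonal to v. In the variables a^2 and |w|^2, F
    is a convex quadratic that vanishes at the minimizer p; so on the path z
    below, whose squared components are affine in th, F (z th) <= th F x. The
    path starts at p and ends at x, outside the ball, so it meets the sphere for
    some th < 1, where F is positive. *)
Lemma lower_sphere_point x : 0 <= dotp x v -> ~ min_ball l1 l2 v x ->
  exists2 y, enorm (y - p) = r & F y < F x.
Proof.
move=> a0 xB; have r0 := ball_radius_gt0.
have vv := dotp_unit v1.
set a := dotp x v in a0 *.
have [w wE] : exists w, w = x - a *: v by eexists.
have xE : x = a *: v + w by rewrite wE addrC subrK.
have wv : dotp w v = 0 by rewrite wE dotpDl dotpNl dotpZl vv mulr1 subrr.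
have vw : dotp v w = 0 by rewrite dotpC.
have s0 := sqrt_l1_gt0; have ss : Num.sqrt l1 * Num.sqrt l1 = l1.
  by rewrite -expr2 sqr_sqrtr ?ltW.
set b2 := dotp w w; have b20 : 0 <= b2 by exact: dotp_ge0.
pose u (th : R) := l1 + th * (a ^+ 2 - l1).
pose z (th : R) := Num.sqrt (u th) *: v + Num.sqrt th *: w.
pose d (th : R) :=
  (Num.sqrt (u th) - Num.sqrt l1) * (Num.sqrt (u th) - Num.sqrt l1) + th * b2.
have u0 th : 0 <= th <= 1 -> 0 <= u th.
  move=> /andP[th0 th1]; have -> : u th = (1 - th) * l1 + th * a ^+ 2 by rewrite /u; ring.
  by rewrite addr_ge0// mulr_ge0 ?sqr_ge0 ?subr_ge0// ltW.
have dE th : 0 <= th <= 1 -> dotp (z th - p) (z th - p) = d th.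
  move=> /andP[th0 th1].
  have -> : z th - p = (Num.sqrt (u th) - Num.sqrt l1) *: v + Num.sqrt th *: w.
    by rewrite /z /p scalerBl addrAC.
  rewrite !(dotpDl, dotpDr, dotpZl, dotpZr) vv vw wv -/b2 /d.
  have -> : Num.sqrt th * (Num.sqrt th * b2) = th * b2.
    by rewrite mulrA -expr2 sqr_sqrtr.
  by ring.
have d0 : d 0 = 0 by rewrite /d /u !mul0r !addr0 subrr mulr0.
have d1 : r ^+ 2 < d 1.
  have z1 : z 1 = x.
    rewrite /z /u mul1r subrKC sqrtr1 scale1r sqrtr_sqr ger0_norm//.
  rewrite -dE ?lexx ?ler01// z1 ltNge; apply/negP => H; apply: xB.
  by rewrite /min_ball /= enorm_leP //; exact: ltW r0.
have cu : continuous (Num.sqrt \o u).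
  move=> th; apply: continuous_comp; last exact: sqrt_continuous.
  exact: cvgD (cvg_cst _) (cvgM cvg_id (cvg_cst _)).
have cd : continuous d.
  have cs : continuous (fun th => Num.sqrt (u th) - Num.sqrt l1).
    by move=> th; exact: cvgB (cu th) (cvg_cst _).
  by move=> th; exact: cvgD (cvgM (cs th) (cs th)) (cvgM cvg_id (cvg_cst _)).
(* d is the squared distance of z th to p. *)
have [th] : exists2 th, th \in `[0, 1] & d th = r ^+ 2.
  apply: IVT => //; first exact: continuous_subspaceT.
  by rewrite d0 minElt maxElt (lt_trans _ d1) ?exprn_gt0// ltW ?exprn_gt0// ltW.
rewrite in_itv /= => th01 dth; have /andP[th0 th1] := th01.
exists (z th).
  by rewrite enormE dE// dth sqrtr_sqr gtr0_norm.
have znorm : enorm (z th - p) = r by rewrite enormE dE// dth sqrtr_sqr gtr0_norm.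
have Fz := excess_sphere_gt0 znorm.
have thlt1 : th < 1.
  by rewrite lt_neqAle th1 andbT; apply: contraTneq d1 => th1'; rewrite -dth th1' ltxx.
have vAw : dotp v (A *m w) = 0 by rewrite dotp_mulmx Asym Av dotpZl vw mulr0.
set q := dotp w (A *m w).
have qw : q <= l1 * b2 by exact: rayleigh.
have Fx : F x = (a ^+ 2 + b2 - l1) ^+ 2 + 2 * (l1 * b2 - q).
  rewrite /excess xE mulmxDr -scalemxAr Av.
  rewrite !(dotpDl, dotpDr, dotpZl, dotpZr) vv vw wv vAw -/b2 -/q; ring.
have Fzth : F (z th) = th ^+ 2 * (a ^+ 2 + b2 - l1) ^+ 2 + 2 * (th * (l1 * b2 - q)).
  have us : Num.sqrt (u th) * Num.sqrt (u th) = u th by rewrite -expr2 sqr_sqrtr// u0.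
  have ts : Num.sqrt th * Num.sqrt th = th by rewrite -expr2 sqr_sqrtr.
  rewrite /excess /z mulmxDr -!scalemxAr Av.
  rewrite !(dotpDl, dotpDr, dotpZl, dotpZr) vv vw wv vAw -/b2 -/q.
  move: us ts; move: (Num.sqrt (u th)) (Num.sqrt th) => U T us ts.
  transitivity ((U * U + T * T * b2 - l1) ^+ 2
    + 2 * (l1 * (U * U + T * T * b2) - (U * U * l1 + T * T * q))); first by ring.
  by rewrite us ts /u; ring.
have Fzx : F (z th) <= th * F x.
  rewrite Fzth Fx; have : 0 <= (a ^+ 2 + b2 - l1) ^+ 2 by exact: sqr_ge0.
  have : 0 <= th * (1 - th) by rewrite mulr_ge0// subr_ge0.
  move: ((_ - _) ^+ 2) => D t1 D0; have := mulr_ge0 t1 D0.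
  lra.
have th_gt0 : 0 < th.
  rewrite lt_neqAle th0 andbT eq_sym; apply: contraTneq (lt_le_trans Fz Fzx) => ->.
  by rewrite mul0r ltxx.
apply: le_lt_trans (Fzx) _; rewrite gtr_pMl//.
by rewrite -(pmulr_rgt0 _ th_gt0); exact: lt_le_trans Fz Fzx.
Qed.

Lemma boundary_min_ball : boundary (min_ball l1 l2 v) = [set y | enorm (y - p) = r].
Proof. exact: boundary_ball ball_radius_gt0. Qed.

Lemma boundary_inf_le y : enorm (y - p) = r ->
  inf (f @` boundary (min_ball l1 l2 v)) <= f y.
Proof.
move=> yr; apply: ge_inf; last by exists y => //; rewrite boundary_min_ball.
exists (\sum_i \sum_j A i j ^+ 2 - l1 ^+ 2) => _ [x _ <-].
by rewrite (objectiveE A l1) lerDl excess_ge0.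
Qed.

End OneBall.

End Basin.

(** * The basin and exact line search *)

Section TwoBalls.
Context (R : realType) (n : nat) (A : 'M[R]_n) (l1 l2 : R).
Hypothesis Asym : A^T = A.
Hypothesis rayleigh : forall x, dotp x (A *m x) <= l1 * dotp x x.
Hypotheses (l1_gt0 : 0 < l1) (l2_lt : l2 < l1).
Implicit Types (x y z v w : 'cV[R]_n).
Local Notation r := (ball_radius l1 l2).
Local Notation f := (objective A).
Local Notation F := (excess A l1).

(** The constant L of the rate: it bounds the second derivatives of f along
    coordinate lines near the minimizers. *)
Definition smoothness : R :=
  12 * l1 + 2 * gap l1 l2 + 4 * \big[Num.max/0]_i `|A i i|.
Local Notation L := smoothness.

Lemma smoothness_gt0 : 0 < L.
Proof.
have := gap_gt0 l1_gt0 l2_lt; have : 0 <= \big[Num.max/0]_i `|A i i|.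
  by elim/big_ind: _ => // a b a0 b0; rewrite le_max a0.
move: l1_gt0; rewrite /L; lra.
Qed.

(** Let y be the endpoint. Since (x_j + y_j)^2 <= 2 |x|^2 + 2 |y|^2, the factor
    of a^2 in [excess_step] is at most 4 |x|^2 + 2 |y|^2 - 2 A_jj, and the
    hypothesis bounds this by L / 2. *)
Lemma quadratic_upper_bound x j a :
  4 * dotp x x + 2 * dotp (x + a *: ebasis R j) (x + a *: ebasis R j)
    <= 6 * l1 + gap l1 l2 ->
  F (x + a *: ebasis R j)
    <= F x + a * gradient f x j 0 + L / 2 * a ^+ 2.
Proof.
move=> xy; rewrite excess_step// gradient_objective// lerD2l mulrC.
apply: ler_wpM2r; first exact: sqr_ge0.
set M := \big[Num.max/0]_i `|A i i|.
have AM : - A j j <= M.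
  apply: (le_trans _ (le_bigmax 0 (fun i => `|A i i|) j)).
  by rewrite -normrN ler_norm.
set y := x + a *: ebasis R j in xy *.
have coord_le z : z j 0 ^+ 2 <= dotp z z.
  rewrite /dotp (bigD1 j)//= -expr2 lerDl.
  by apply: sumr_ge0 => k _; rewrite -expr2 sqr_ge0.
have yj : y j 0 = x j 0 + a by rewrite !mxE !eqxx mulr1.
have := coord_le y; have := coord_le x; have := sqr_ge0 (y j 0 - x j 0).
rewrite yj /L -/M; move: xy AM.
move: (dotp x x) (dotp y y) (x j 0) => X Y c; lra.
Qed.

(** The wanted step is the minimizer -g/L of the quadratic upper bound, if it is
    short enough for the bound to apply. If it were longer than 5r/2, the bound
    would still apply to the step of length 5r/2 in the same direction; that
    step ends outside both balls and lowers F, which contradicts the hypothesis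
    on the points outside. *)
Lemma coordinate_descent v x j : enorm v = 1 ->
  min_ball l1 l2 v x ->
  (forall y, ~ min_ball l1 l2 v y -> ~ min_ball l1 l2 (- v) y -> F x < F y) ->
  exists a, F (x + a *: ebasis R j) <= F x - gradient f x j 0 ^+ 2 / (2 * L).
Proof.
move=> v1 xB outside; set g := gradient f x j 0.
have L0 := smoothness_gt0; have r0 := ball_radius_gt0 l1_gt0 l2_lt.
have s0 := sqrt_l1_gt0 l1_gt0; have rs := ball_radius_le l2 l1_gt0.
have ss : Num.sqrt l1 * Num.sqrt l1 = l1 by rewrite -expr2 sqr_sqrtr// ltW.
set p := Num.sqrt l1 *: v.
have pn : enorm p = Num.sqrt l1 by rewrite enormZ v1 mulr1 gtr0_norm.
have xp : enorm (x - p) <= r by [].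
pose y a := x + a *: ebasis R j.
have yx a : enorm (y a - x) = `|a|.
  by rewrite /y addrAC subrr add0r enormZ enorm_ebasis mulr1.
have xs : dotp x x <= (Num.sqrt l1 + r) ^+ 2.
  rewrite -enorm_leP ?addr_ge0 ?(ltW s0) ?(ltW r0)//.
  by rewrite -(subrK p x) addrC (le_trans (enormD _ _))// pn lerD2l.
(* With s = sqrt l1, 4 (s + r)^2 + 2 (s + 7r/2)^2 <= 6 s^2 + 30 s r because
   15 r <= s, and 30 s r is the gap. *)
have bound a : `|a| <= 5 / 2 * r -> F (y a) <= F x + a * g + L / 2 * a ^+ 2.
  move=> ar; apply: quadratic_upper_bound.
  have ys : dotp (y a) (y a) <= (Num.sqrt l1 + 7 / 2 * r) ^+ 2.
    rewrite -enorm_leP; last by move: r0 s0; lra.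
    rewrite -(subrK x (y a)) addrC (le_trans (enormD _ _))// yx.
    have : enorm x <= Num.sqrt l1 + r.
      by rewrite enorm_leP//; move: r0 s0; lra.
    lra.
  have rr : r * r <= Num.sqrt l1 * r / 15.
    by have := ler_wpM2r (ltW r0) rs; lra.
  have srr : 0 <= Num.sqrt l1 * r by rewrite mulr_ge0 ?ltW.
  move: xs ys; rewrite (gap_radius l2 l1_gt0) -/(y a); lra.
have [gL|gL] := leP `|g| (5 / 2 * r * L).
  exists (- (g / L)); have -> : F x - g ^+ 2 / (2 * L) =
    F x + - (g / L) * g + L / 2 * (- (g / L)) ^+ 2 by field; rewrite gt_eqF.
  by apply: bound; rewrite normrN normrM normfV (gtr0_norm L0) ler_pdivrMr.
pose a := - (Num.sg g * (5 / 2 * r)).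
have g0 : g != 0.
  by apply: contraTneq gL => ->; rewrite normr0 -leNgt;
    rewrite mulr_ge0 ?(ltW L0)//; move: r0; lra.
have an : `|a| = 5 / 2 * r.
  by rewrite normrN normrM normr_sg g0 mul1r gtr0_norm// mulr_gt0.
have ag : a * g = - (5 / 2 * r * `|g|).
  by rewrite normrEsg /a; ring.
have a2 : a ^+ 2 = (5 / 2 * r) ^+ 2 by rewrite -an real_normK ?num_real.
(* 5r/2 exceeds the diameter 2r of the ball around p, and the centre -p of the
   other ball lies at distance 2 sqrt l1 >= 30 r from p. *)
have : F x < F (y a).
  apply: outside; rewrite /min_ball /= => H.
    have : enorm (y a - x) <= enorm (y a - p) + enorm (p - x).
      by have := enormD (y a - p) (p - x); rewrite addrA subrK.
    rewrite yx an (enormB p); move: H xp; rewrite -/p -/r; lra.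
  have H1 : enorm (2 *: p) <= enorm (y a + p) + (enorm (x - y a) + enorm (p - x)).
    have := enormD (y a + p) ((x - y a) + (p - x)); have := enormD (x - y a) (p - x).
    have -> : y a + p + (x - y a + (p - x)) = 2 *: p.
      by rewrite scaler_nat mulr2n; apply/matrixP => i k; rewrite !mxE; ring.
    lra.
  move: H1 H; rewrite enormZ pn scalerN opprK -/p -/r (enormB x) yx an (enormB p).
  rewrite gtr0_norm//; move: xp rs; lra.
have := bound a; rewrite an lexx => /(_ isT); rewrite ag a2 => H1 H2.
have : 5 / 2 * r * `|g| < L / 2 * (5 / 2 * r) ^+ 2 by lra.
have : 5 / 2 * r * (5 / 2 * r * L) < 5 / 2 * r * `|g| by rewrite ltr_pM2l// mulr_gt0.
have : 0 <= L * (r * r).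
  by apply: mulr_ge0; [exact: ltW|apply: mulr_ge0; exact: ltW].
move=> *; exfalso; lra.
Qed.

Section Basin.
Context (v : 'cV[R]_n) (mu2 : R).
Hypotheses (Av : A *m v = l1 *: v) (v1 : enorm v = 1).
Hypothesis sc2p : strongly_convex 2 mu2 f (min_ball l1 l2 v).
Hypothesis sc2m : strongly_convex 2 mu2 f (min_ball l1 l2 (- v)).
Local Notation c := (inf (f @` boundary (min_ball l1 l2 v))).

Let AvN : A *m (- v) = l1 *: (- v). Proof. by rewrite mulmxN Av scalerN. Qed.
Let v1N : enorm (- v) = 1. Proof. by rewrite enormN. Qed.

Lemma min_ballN u x : min_ball l1 l2 (- u) (- x) = min_ball l1 l2 u x.
Proof. by rewrite /min_ball /= scalerN -opprD enormN. Qed.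

(** The union of D^+ and D^- ([boundary_sublevelE]): as f is even, its minimum
    on the boundary is the same for both balls, and one level suffices. *)
Definition basin : set 'cV[R]_n :=
  [set x | (min_ball l1 l2 v x \/ min_ball l1 l2 (- v) x) /\ f x <= c].

(** As f is even, one may assume x.v >= 0; a point of the sphere around
    sqrt l1 v is then lower than x. *)
Lemma above_level x :
  ~ min_ball l1 l2 v x -> ~ min_ball l1 l2 (- v) x -> c < f x.
Proof.
wlog a0 : x / 0 <= dotp x v => [H xp xm|xp _].
  have [/H|a0] := leP 0 (dotp x v); first exact.
  rewrite -objectiveN//; apply: H; first by rewrite dotpNl oppr_ge0 ltW.
    by rewrite -{1}(opprK v) min_ballN.
  by rewrite min_ballN.
have [y yr Fyx] := lower_sphere_point Asym rayleigh l1_gt0 l2_lt Av v1 sc2p a0 xp.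
apply: le_lt_trans (boundary_inf_le rayleigh l1_gt0 l2_lt yr) _.
by rewrite !(objectiveE A l1) ltrD2l.
Qed.

Lemma boundary_levelN : inf (f @` boundary (min_ball l1 l2 (- v))) = c.
Proof.
congr inf; rewrite !boundary_min_ball//.
apply/seteqP; split=> _ [y /= yr <-]; exists (- y); rewrite ?objectiveN//=.
  by rewrite -opprD enormN; move: yr; rewrite scalerN opprK.
by rewrite scalerN opprK addrC enormB.
Qed.

Lemma boundary_sublevelE :
  boundary_sublevel f (min_ball l1 l2 v) `|` boundary_sublevel f (min_ball l1 l2 (- v))
  = basin.
Proof.
rewrite /boundary_sublevel boundary_levelN; apply/seteqP; split=> x /=.
  by move=> [[xB fx]|[xB fx]]; split=> //; [left|right].
by move=> [[xB|xB] fx]; [left|right].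
Qed.

(** The line search may leave the ball it starts from, or change balls; by
    [above_level] it cannot leave both without exceeding the level. *)
Lemma basin_sublevel x y : basin x -> f y <= f x -> basin y.
Proof.
move=> [_ fx] fyx; have fy := le_trans fyx fx; split=> //.
have [yp|yp] := pselect (min_ball l1 l2 v y); first by left.
have [ym|ym] := pselect (min_ball l1 l2 (- v) y); first by right.
by have := above_level yp ym; rewrite ltNge fy.
Qed.

Lemma basin_descent x j : basin x ->
  exists a, F (x + a *: ebasis R j) <= F x - gradient f x j 0 ^+ 2 / (2 * L).
Proof.
move=> [xB fx].
have out y : ~ min_ball l1 l2 v y -> ~ min_ball l1 l2 (- v) y -> F x < F y.
  move=> yp ym; rewrite -(ltrD2l (\sum_i \sum_j A i j ^+ 2 - l1 ^+ 2)) -!objectiveE.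
  exact: le_lt_trans fx (above_level yp ym).
case: xB => xB; first exact: coordinate_descent v1 xB out.
by apply: coordinate_descent v1N xB _ => y; rewrite opprK => ? ?; exact: out.
Qed.

Lemma basin_distance x : basin x ->
  dist x (minimizers f) ^+ 2 <= 2 / mu2 * F x.
Proof.
have mu20 : 0 < mu2 by case: sc2p.
have key u : A *m u = l1 *: u -> enorm u = 1 ->
    strongly_convex 2 mu2 f (min_ball l1 l2 u) ->
    min_ball l1 l2 u x -> dist x (minimizers f) ^+ 2 <= 2 / mu2 * F x.
  move=> Au u1 scu xB.
  have := quadratic_growth Asym l1_gt0 l2_lt Au u1 scu xB.
  have lb : lbound [set enorm (x - y) | y in minimizers f] 0.
    by move=> _ [y _ <-]; exact: enorm_ge0.
  have mu : minimizers f (Num.sqrt l1 *: u) by exact: minimizer_in.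
  have d0 : 0 <= dist x (minimizers f).
    by apply: lb_le_inf => //; exists (enorm (x - Num.sqrt l1 *: u));
       exists (Num.sqrt l1 *: u).
  have dx : dist x (minimizers f) <= enorm (x - Num.sqrt l1 *: u).
    by apply: ge_inf; [exists 0|exists (Num.sqrt l1 *: u)].
  have dx2 : dist x (minimizers f) ^+ 2 <= enorm (x - Num.sqrt l1 *: u) ^+ 2.
    by rewrite ler_sqr ?nnegrE// enorm_ge0.
  move=> qg; apply: (le_trans dx2).
  rewrite -(@ler_pM2l _ (mu2 / 2)) ?divr_gt0//; apply: (le_trans qg).
  by suff -> : mu2 / 2 * (2 / mu2 * F x) = F x by []; field; rewrite gt_eqF.
by move=> [[xB|xB] _]; [apply: key xB|apply: key xB].
Qed.

End Basin.
End TwoBalls.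

(** * Hoelder's inequality and power sums of the gradient *)

Section Holder.
Context (R : realType).

(** Once both factors are normalized to norm 1, this is Young's inequality term
    by term; if one of the norms vanishes, so does every product. *)
Lemma holder_sum (I : finType) (a b : I -> R) (p q : R) :
  (forall i, 0 <= a i) -> (forall i, 0 <= b i) ->
  0 < p -> 0 < q -> p^-1 + q^-1 = 1 ->
  \sum_i a i * b i
    <= (\sum_i a i `^ p) `^ p^-1 * (\sum_i b i `^ q) `^ q^-1.
Proof.
move=> a0 b0 p0 q0 pq.
have zero (c d : I -> R) (s : R) : 0 < s -> \sum_i c i `^ s = 0 ->
    \sum_i c i * d i = 0.
  move=> s0 /eqP; rewrite psumr_eq0 => [/allP c0|i _]; last exact: powR_ge0.
  apply: big1 => i _; have := c0 i (mem_index_enum i).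
  by move=> /eqP/powR_eq0_eq0 ->; rewrite mul0r.
have rhs0 : 0 <= (\sum_i a i `^ p) `^ p^-1 * (\sum_i b i `^ q) `^ q^-1.
  by rewrite mulr_ge0// powR_ge0.
have [Sa0|Sa] := eqVneq (\sum_i a i `^ p) 0; first by rewrite (zero _ _ _ p0 Sa0).
have [Sb0|Sb] := eqVneq (\sum_i b i `^ q) 0.
  by under eq_bigr do rewrite mulrC; rewrite (zero _ _ _ q0 Sb0).
move: rhs0 => _.
have Sagt0 : 0 < \sum_i a i `^ p.
  by rewrite lt_def Sa; apply: sumr_ge0 => i _; exact: powR_ge0.
have Sbgt0 : 0 < \sum_i b i `^ q.
  by rewrite lt_def Sb; apply: sumr_ge0 => i _; exact: powR_ge0.
set G := _ `^ p^-1; set Z := _ `^ q^-1.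
have G0 : 0 < G by exact: powR_gt0.
have Z0 : 0 < Z by exact: powR_gt0.
have Gp : G `^ p = \sum_i a i `^ p by rewrite -powRrM mulVf ?gt_eqF// powRr1// ltW.
have Zq : Z `^ q = \sum_i b i `^ q by rewrite -powRrM mulVf ?gt_eqF// powRr1// ltW.
clearbody G Z.
have -> : \sum_i a i * b i = G * Z * \sum_i (a i / G) * (b i / Z).
  have cancel (x y u w : R) : u != 0 -> w != 0 -> x * y = u * w * (x / u * (y / w)).
    by move=> u0 w0; rewrite mulrACA (mulrC u) (mulrC w) !divfK.
  by rewrite mulr_sumr; apply: eq_bigr => i _; apply: cancel; rewrite gt_eqF.
rewrite ger_pMr ?mulr_gt0//.
have <- : \sum_i ((a i / G) `^ p / p + (b i / Z) `^ q / q) = 1.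
  rewrite big_split /= -!mulr_suml -pq.
  have scale (c : I -> R) (K s : R) : (forall i, 0 <= c i) -> 0 < K ->
      K `^ s = \sum_i c i `^ s -> 0 < s -> \sum_i (c i / K) `^ s = 1.
    move=> c0 K0 Ks s0.
    have -> : \sum_i (c i / K) `^ s = (\sum_i c i `^ s) / K `^ s.
      rewrite mulr_suml; apply: eq_bigr => i _.
      by rewrite powRM ?invr_ge0 ?(ltW K0)// -powR_inv1 ?(ltW K0)//
        powRAC powR_inv1// powR_ge0.
    by rewrite -Ks divff// gt_eqF// powR_gt0.
  by rewrite !scale// !mul1r.
by apply: ler_sum => i _; apply: conjugate_powR => //; rewrite divr_ge0// ltW.
Qed.

End Holder.

Section GradientSampling.
Context (R : realType) (n : nat) (t : R).
Hypothesis t0 : 0 <= t.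
Implicit Types g z : 'cV[R]_n.

Definition power_sum g (s : R) : R := \sum_j `|g j 0| `^ s.

Lemma power_sum_ge0 g s : 0 <= power_sum g s.
Proof. by apply: sumr_ge0 => j _; exact: powR_ge0. Qed.

Let t2 : 0 < t + 2. Proof. by rewrite ltr_wpDl. Qed.

(** Hoelder's inequality for the conjugate exponents t + 2 and
    (t + 2) / (t + 1). *)
Lemma dual_pairing_le g z :
  - \sum_j g j 0 * z j 0
    <= power_sum g (t + 2) `^ (t + 2)^-1 * pnorm ((t + 2) / (t + 1)) z.
Proof.
have t1 : 0 < t + 1 by rewrite ltr_wpDl.
apply: le_trans (holder_sum _ _ t2 _ _) => //.
- rewrite -sumrN; apply: ler_sum => j _.
  by rewrite -normrM -normrN ler_norm.
- by rewrite divr_gt0.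
- by field; rewrite !gt_eqF.
Qed.

(** Hoelder's inequality for |g_j|^t and the constant 1, with the exponents
    (t + 2) / t and (t + 2) / 2. For t = 0 the first of them is infinite, and
    both sides are equal. *)
Lemma power_sum_ratio g :
  power_sum g (t + 2) `^ (2 / (t + 2)) * power_sum g t
    <= n%:R `^ (2 / (t + 2)) * power_sum g (t + 2).
Proof.
have S0 := power_sum_ge0 g (t + 2).
have [t00|tn0] := eqVneq t 0.
  rewrite t00 add0r divff// !powRr1 ?power_sum_ge0// mulrC ler_wpM2r ?power_sum_ge0//.
  rewrite /power_sum; under eq_bigr do rewrite powRr0.
  by rewrite sumr_const card_ord.
have tgt0 : 0 < t by rewrite lt_def tn0.
have W : power_sum g t <= power_sum g (t + 2) `^ (t / (t + 2)) * n%:R `^ (2 / (t + 2)).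
  have -> : power_sum g t = \sum_j `|g j 0| `^ t * 1.
    by apply: eq_bigr => j _; rewrite mulr1.
  have -> : power_sum g (t + 2) = \sum_j (`|g j 0| `^ t) `^ ((t + 2) / t).
    by apply: eq_bigr => j _; rewrite -powRrM mulrC divfK.
  have -> : n%:R = \sum_(j < n) (1 : R) `^ ((t + 2) / 2).
    by under eq_bigr do rewrite powR1; rewrite sumr_const card_ord.
  rewrite -[t / _]invf_div -[2 / _]invf_div; apply: holder_sum => //.
  - by rewrite divr_gt0.
  - by rewrite divr_gt0.
  - by rewrite !invf_div -mulrDl divff// gt_eqF.
apply: (le_trans (ler_wpM2l (powR_ge0 _ _) W)).
rewrite mulrA -powRD; last by rewrite -mulrDl [2 + t]addrC divff ?oner_eq0// gt_eqF.
by rewrite -mulrDl [2 + t]addrC divff; [rewrite powRr1// mulrC|rewrite gt_eqF].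
Qed.

Lemma weighted_square_sum g :
  \sum_j `|g j 0| `^ t * g j 0 ^+ 2 = power_sum g (t + 2).
Proof.
apply: eq_bigr => j _; rewrite powRD; last by rewrite gt_eqF.
by rewrite powR_mulrn// real_normK// num_real.
Qed.

Lemma power_sum0 g : power_sum g t = 0 -> g = 0.
Proof.
move=> /eqP; rewrite psumr_eq0 => [/allP g0|j _]; last exact: powR_ge0.
apply/matrixP => j k; rewrite ord1 mxE.
by have := g0 j (mem_index_enum j) => /eqP/powR_eq0_eq0/normr0_eq0.
Qed.

End GradientSampling.

(** * Integrals against a conditional distribution *)

Section Sampling.
Context d (T : measurableType d) (R : realType) (mu : {measure set T -> \bar R}).
Context (G : set (set T)) (D E0 : set T) (p : T -> R).
Hypotheses (Gm : <<s G >> `<=` measurable) (mD : measurable D) (GE0 : <<s G >> E0).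
Hypotheses (p0 : forall x, 0 <= p x) (mp : measurable_fun setT p).
Hypothesis sample : forall E, <<s G >> E -> E `<=` E0 ->
  (mu (E `&` D) = \int[mu]_(x in E) (p x)%:E)%E.

Local Notation GT := (g_sigma_algebraType G).

Import HBNNSimple.

Lemma integral_sample_indic (k : R) (B : set T) : <<s G >> B -> (k < 0 -> B = set0) ->
  (\int[mu]_(x in E0 `&` D) (k * \1_B x)%:E = \int[mu]_(x in E0) (k * \1_B x * p x)%:E)%E.
Proof.
move=> GB kB; have mB := Gm GB; have mE0 := Gm GE0.
have mE0D : measurable (E0 `&` D) by exact: measurableI.
have [k0|/kB ->] := leP 0 k; last first.
  by rewrite !integral0_eq// => x _; rewrite indic0 /= ?mulr0 ?mul0r.
have GEB : <<s G >> (E0 `&` B).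
  exact: (@measurableI _ GT).
under eq_integral do rewrite EFinM.
rewrite ge0_integralZl_EFin//=; last exact/measurable_EFinP.
rewrite integral_indic//.
have -> : B `&` (E0 `&` D) = E0 `&` B `&` D by rewrite setIA (setIC B).
rewrite sample//.
under [RHS]eq_integral do rewrite -mulrA EFinM.
rewrite ge0_integralZl_EFin//=.
- congr (_ * _)%E; rewrite integral_mkcondr.
  apply: eq_integral => x _; rewrite epatch_indic -EFinM mulrC //.
- by move=> x _; rewrite lee_fin mulr_ge0.
- apply/measurable_EFinP; apply: measurable_funM => //.
  exact: measurable_funTS.
Qed.

Lemma integral_sample_nnsfun (s : {nnsfun GT >-> R}) :
  (\int[mu]_(x in E0 `&` D) (s x)%:E = \int[mu]_(x in E0) (s x * p x)%:E)%E.
Proof.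
have mE0 := Gm GE0; have mE0D : measurable (E0 `&` D) by exact: measurableI.
have Gs (k : R) : <<s G >> (s @^-1` [set k]).
  have := @measurable_sfunP _ _ _ _ s [set k].
  by apply; exact: measurable_set1.
have ms (k : R) : measurable_fun setT (fun x : T => k * \1_(s @^-1` [set k]) x).
  by apply: measurable_funM => //; apply: measurable_indic; exact/Gm.
transitivity (\sum_(k \in range s)
    \int[mu]_(x in E0 `&` D) (k * \1_(s @^-1` [set k]) x)%:E)%E.
  under eq_integral do rewrite fimfunE -fsumEFin//.
  rewrite ge0_integral_fsum//.
  - by move=> k; apply/measurable_EFinP; exact: measurable_funTS.
  - by move=> k x _; rewrite nnfun_muleindic_ge0.
transitivity (\sum_(k \in range s)
    \int[mu]_(x in E0) (k * \1_(s @^-1` [set k]) x * p x)%:E)%E.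
  apply: eq_fsbigr => k _; apply: integral_sample_indic => // k0.
  exact: (@preimage_nnfun0 GT R s k k0).
rewrite -ge0_integral_fsum//.
- apply: eq_integral => x _; rewrite fsumEFin// [in RHS]fimfunE.
  by rewrite mulr_fsuml.
- move=> k; apply/measurable_EFinP; apply: measurable_funM; exact: measurable_funTS.
- by move=> k x _; rewrite EFinM mule_ge0 ?nnfun_muleindic_ge0// lee_fin.
Qed.

(** The sampling rule passes from events of G to simple functions by linearity,
    and to nonnegative functions by monotone convergence. The simple functions
    have to be built from events of G, whence the measurability of h with
    respect to G rather than to the ambient sigma-algebra. *)
Lemma integral_sample (h : T -> R) : (forall x, 0 <= h x) ->
  measurable_fun setT (h : GT -> R) ->
  (\int[mu]_(x in E0 `&` D) (h x)%:E = \int[mu]_(x in E0) (h x * p x)%:E)%E.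
Proof.
move=> h0 mh; have mE0 := Gm GE0; have mE0D : measurable (E0 `&` D) by exact: measurableI.
have mhE : measurable_fun [set: GT] (EFin \o h : GT -> \bar R) by exact/measurable_EFinP.
pose s := nnsfun_approx (@measurableT _ GT) mhE.
have s_cvg x : (EFin \o s^~ x) @ \oo --> (h x)%:E.
  by apply: cvg_nnsfun_approx => // y _; rewrite lee_fin.
have s_nd x : {homo s^~ x : m n / (m <= n)%N >-> m <= n}.
  by move=> m n mn; exact/lefP/nd_nnsfun_approx.
have ms n : measurable_fun [set: T] (s n).
  move=> _ B mB; rewrite setTI; apply: Gm.
  by rewrite -[X in <<s G >> X]setTI; exact: (measurable_funP (s n)).
transitivity (limn (fun n => \int[mu]_(x in E0 `&` D) (s n x)%:E)%E).
  rewrite -monotone_convergence//.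
  - by apply: eq_integral => x _; apply/esym/cvg_lim => //; exact: s_cvg.
  - by move=> n; apply/measurable_EFinP; exact: measurable_funTS.
  - by move=> n x _; rewrite lee_fin.
  - by move=> x _ m n mn; rewrite lee_fin; exact: s_nd.
under eq_fun do rewrite integral_sample_nnsfun.
rewrite -monotone_convergence//.
- apply: eq_integral => x _; apply/cvg_lim => //.
  under eq_fun do rewrite EFinM.
  rewrite EFinM; apply: cvgeZr => //; exact: s_cvg.
- move=> n; apply/measurable_EFinP; apply: measurable_funM; exact: measurable_funTS.
- by move=> n x _; rewrite lee_fin mulr_ge0.
- by move=> x _ m n mn; rewrite lee_fin ler_wpM2r//; exact: s_nd.
Qed.

End Sampling.

(** The integral of a nonnegative function is the supremum of the integrals of
    the simple functions below it, hence monotone. This form is applied to the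
    squared distance to the minimizers, which is an infimum over a set. *)
Lemma ge0_le_integral_nonmeasurable d (T : measurableType d) (R : realType)
    (mu : {measure set T -> \bar R}) (f g : T -> \bar R) :
  (forall x, (0 <= f x)%E) -> (forall x, (f x <= g x)%E) ->
  (\int[mu]_x f x <= \int[mu]_x g x)%E.
Proof.
move=> f0 fg; have g0 x : (0 <= g x)%E by exact: le_trans (f0 x) (fg x).
rewrite !ge0_integralTE//; apply: le_ereal_sup => _ [s sf <-].
by exists s => // x; exact: le_trans (sf x) (fg x).
Qed.

(** * Mean decrease in one step *)

Section MeanDecrease.
Context (R : realType) (n : nat) (A : 'M[R]_n) (l1 l2 : R).
Hypothesis Asym : A^T = A.
Hypothesis rayleigh : forall x, dotp x (A *m x) <= l1 * dotp x x.
Hypotheses (l1_gt0 : 0 < l1) (l2_lt : l2 < l1) (n_gt0 : (0 < n)%N).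
Context (t : R).
Hypothesis t_ge0 : 0 <= t.
Implicit Types (x y z v w : 'cV[R]_n).
Local Notation f := (objective A).
Local Notation F := (excess A l1).
Local Notation L := (smoothness A l1 l2).
Local Notation q := ((t + 2) / (t + 1)).

(** Strong convexity between x and the minimizer gives F x <= G Z - mu/2 Z^2,
    with G the dual norm of the gradient and Z the q-norm of the difference; the
    right-hand side is at most G^2 / (2 mu) for every Z. *)
Lemma gradient_dominance u muq x : A *m u = l1 *: u -> enorm u = 1 ->
  strongly_convex q muq f (min_ball l1 l2 u) -> min_ball l1 l2 u x ->
  F x <= (power_sum (gradient f x) (t + 2) `^ (t + 2)^-1) ^+ 2 / (2 * muq).
Proof.
move=> Au u1 [mu0 _ _ sc] xB.
have pB := minimizer_in_ball l1_gt0 l2_lt u.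
have := sc _ _ xB pB; rewrite !(objectiveE A l1) excess_minimizer// addr0.
have := dual_pairing_le t_ge0 (gradient f x) (Num.sqrt l1 *: u - x).
move: (\sum_j _) (pnorm _ _) (_ `^ _) => Gz Z G GZ H.
have : F x <= G * Z - muq / 2 * Z ^+ 2 by move: H; lra.
move=> /le_trans; apply.
rewrite -subr_ge0.
have -> : G ^+ 2 / (2 * muq) - (G * Z - muq / 2 * Z ^+ 2)
    = (G - muq * Z) ^+ 2 / (2 * muq) by field; rewrite gt_eqF.
by rewrite divr_ge0 ?sqr_ge0// mulr_ge0// ltW.
Qed.

Section Basin.
Context (v : 'cV[R]_n) (muq : R).
Hypotheses (Av : A *m v = l1 *: v) (v1 : enorm v = 1).
Hypothesis scp : strongly_convex q muq f (min_ball l1 l2 v).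
Hypothesis scm : strongly_convex q muq f (min_ball l1 l2 (- v)).

Lemma basin_gradient_dominance x : basin A l1 l2 v x ->
  F x <= (power_sum (gradient f x) (t + 2) `^ (t + 2)^-1) ^+ 2 / (2 * muq).
Proof.
move=> [[xB|xB] _]; first exact: gradient_dominance Av v1 scp xB.
apply: (gradient_dominance _ _ scm xB); first by rewrite mulmxN Av scalerN.
by rewrite enormN.
Qed.

(** The relative decrease of F per step: one minus the rate. *)
Definition descent_rate : R := muq / (L * n%:R `^ (2 - 2 / q)).

Lemma descent_rate_gt0 : 0 < descent_rate.
Proof.
have mu0 : 0 < muq by case: scp.
by rewrite divr_gt0// mulr_gt0 ?smoothness_gt0// powR_gt0// ltr0n.
Qed.

(** The mean of the squared partial derivatives is the quotient of power sums
    bounded below in [power_sum_ratio]. *)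
Lemma mean_decrease x : basin A l1 l2 v x ->
  \sum_j coord_weight t f x j != 0 ->
  descent_rate * F x <= \sum_j gradient f x j 0 ^+ 2 / (2 * L) * coord_prob t f x j.
Proof.
move=> xB W0; have L0 := smoothness_gt0 A l1_gt0 l2_lt.
have mu0 : 0 < muq by case: scp.
have FG := basin_gradient_dominance xB.
have t2 : 0 < t + 2 by rewrite ltr_wpDl.
have t1 : 0 < t + 1 by rewrite ltr_wpDl.
have exponent : 2 - 2 / q = 2 / (t + 2) by field; rewrite !gt_eqF.
rewrite /descent_rate exponent.
have WE : \sum_j coord_weight t f x j = power_sum (gradient f x) t by [].
rewrite WE in W0; have ratio := power_sum_ratio t_ge0 (gradient f x).
have Wgt0 : 0 < power_sum (gradient f x) t by rewrite lt_def W0 power_sum_ge0.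
have Ngt0 : 0 < n%:R `^ (2 / (t + 2)) :> R by rewrite powR_gt0// ltr0n.
have -> : \sum_j gradient f x j 0 ^+ 2 / (2 * L) * coord_prob t f x j
    = power_sum (gradient f x) (t + 2) / power_sum (gradient f x) t / (2 * L).
  rewrite -(weighted_square_sum t_ge0) !mulr_suml; apply: eq_bigr => j _.
  by rewrite /coord_prob WE /coord_weight mulrAC [in LHS]mulrCA [in LHS]mulrA.
have G2 : (power_sum (gradient f x) (t + 2) `^ (t + 2)^-1) ^+ 2
    = power_sum (gradient f x) (t + 2) `^ (2 / (t + 2)).
  by rewrite -powR_mulrn ?powR_ge0// -powRrM mulrC.
rewrite G2 in FG; move: FG ratio Wgt0 Ngt0 mu0 L0.
move: (power_sum _ _ `^ _) => G; move: (n%:R `^ _) => N; move: (F x) L => Fx K.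
move: (power_sum _ (t + 2)) (power_sum _ t) => S W FG ratio W0' N0 mu0' K0.
apply: (@le_trans _ _ (muq / (K * N) * (G / (2 * muq)))).
  by apply: ler_wpM2l => //; apply: divr_ge0; [|apply: mulr_ge0]; exact: ltW.
have -> : muq / (K * N) * (G / (2 * muq)) = G / N / (2 * K).
  by field; rewrite !gt_eqF.
apply: ler_wpM2r; first by rewrite invr_ge0 mulr_ge0// ltW.
by rewrite ler_pdivrMr// mulrAC ler_pdivlMr// [S * N]mulrC.
Qed.

(** Where the sampling is unconstrained the gradient vanishes, and gradient
    dominance shows that the minimum is already reached. *)
Lemma no_weight_excess0 x : basin A l1 l2 v x ->
  \sum_j coord_weight t f x j = 0 -> F x = 0.
Proof.
move=> xB /(power_sum0 (g := gradient f x)) g0.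
apply/eqP; rewrite eq_le excess_ge0// andbT.
apply: le_trans (basin_gradient_dominance xB) _; rewrite g0 /power_sum.
have t2 : t + 2 != 0 by rewrite gt_eqF// ltr_wpDl.
rewrite big1; last by move=> j _; rewrite mxE normr0 powR0.
by rewrite powR0 ?invr_eq0// expr0n mul0r.
Qed.

End Basin.
End MeanDecrease.

Section Measurability.
Context d (T : measurableType d) (R : realType) (n : nat) (A : 'M[R]_n).
Context (Y : T -> 'cV[R]_n).
Hypothesis mY : forall i, measurable_fun setT (fun w => Y w i 0).
Hypothesis Asym : A^T = A.

Let mAY i : measurable_fun setT (fun w => (A *m Y w) i 0).
Proof.
have -> : (fun w => (A *m Y w) i 0) = (fun w => \sum_k A i k * Y w k 0).
  by apply/funext => w; rewrite mxE.
by apply: measurable_sum => k; apply: measurable_funM.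
Qed.

Let mdotp : measurable_fun setT (fun w => dotp (Y w) (Y w)).
Proof. by apply: measurable_sum => k; apply: measurable_funM. Qed.

Lemma measurable_excess l1 : measurable_fun setT (fun w => excess A l1 (Y w)).
Proof.
apply: measurable_funD.
  by apply: measurable_funX; apply: measurable_funB.
apply: measurable_funM => //; apply: measurable_funB.
  exact: measurable_funM.
by apply: measurable_sum => k; apply: measurable_funM.
Qed.

Lemma measurable_gradient j :
  measurable_fun setT (fun w => gradient (objective A) (Y w) j 0).
Proof.
have -> : (fun w => gradient (objective A) (Y w) j 0) =
    (fun w => 4 * (dotp (Y w) (Y w) * Y w j 0 - (A *m Y w) j 0)).
  by apply/funext => w; rewrite gradient_objective.
apply: measurable_funM => //; apply: measurable_funB => //.
exact: measurable_funM.
Qed.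

Lemma measurable_coord_weight t j :
  measurable_fun setT (fun w => coord_weight t (objective A) (Y w) j).
Proof.
apply: (measurableT_comp (measurable_powR t)).
by apply: measurableT_comp => //; exact: measurable_gradient.
Qed.

Lemma measurable_coord_prob t j :
  measurable_fun setT (fun w => coord_prob t (objective A) (Y w) j).
Proof.
(* The inverse of the nonnegative total weight is its power of exponent -1,
   and powers are measurable. *)
have -> : (fun w => coord_prob t (objective A) (Y w) j) =
  (fun w => coord_weight t (objective A) (Y w) j *
     (\sum_i coord_weight t (objective A) (Y w) i) `^ (-1)).
  apply/funext => w; rewrite powR_inv1//.
  by apply: sumr_ge0 => i _; exact: powR_ge0.
apply: measurable_funM; first exact: measurable_coord_weight.
apply: (measurableT_comp (measurable_powR _)).
by apply: measurable_sum => i; exact: measurable_coord_weight.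
Qed.

End Measurability.

(** * Convergence of the expectations *)

(** For negative rho the two hypotheses force u to vanish. *)
Lemma geometric_decay (R : realFieldType) (rho : R) (u : nat -> R) :
  (forall l, 0 <= u l) -> (forall l, u l.+1 <= rho * u l) ->
  forall l, u l <= rho ^+ l * u 0%N.
Proof.
move=> u0 ur; have [rho0|rho0] := leP 0 rho.
  elim=> [|l IH]; first by rewrite mul1r.
  by apply: le_trans (ur l) _; rewrite exprS -mulrA ler_wpM2l.
have uz l : u l = 0.
  by apply/eqP; rewrite eq_le u0 andbT -(nmulr_rge0 _ rho0) (le_trans (u0 _) (ur l)).
by move=> l; rewrite !uz mulr0.
Qed.

(** The generators of [history], named so that the sigma-algebra of the past can
    serve as a measurable structure on T. *)
Definition history_generators (T : Type) (R : realType) (n : nat)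
    (X : nat -> T -> 'cV[R]_n) (J : nat -> T -> 'I_n) (l : nat) : set (set T) :=
  [set E | (exists k i (B : set R),
              [/\ (k <= l)%N, measurable B & E = [set w | B (X k w i 0)]])
           \/ (exists k j, (k < l)%N /\ E = [set w | J k w = j]) ].

Section Run.
Context (R : realType) (n : nat) (A : 'M[R]_n) (l1 l2 : R).
Hypothesis Asym : A^T = A.
Hypothesis rayleigh : forall x, dotp x (A *m x) <= l1 * dotp x x.
Hypotheses (l1_gt0 : 0 < l1) (l2_lt : l2 < l1) (n_gt0 : (0 < n)%N).
Context (t : R).
Hypothesis t_ge0 : 0 <= t.
Local Notation f := (objective A).
Local Notation F := (excess A l1).
Local Notation L := (smoothness A l1 l2).
Local Notation q := ((t + 2) / (t + 1)).
Context (v : 'cV[R]_n) (muq mu2 : R).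
Hypotheses (Av : A *m v = l1 *: v) (v1 : enorm v = 1).
Hypothesis scqp : strongly_convex q muq f (min_ball l1 l2 v).
Hypothesis scqm : strongly_convex q muq f (min_ball l1 l2 (- v)).
Hypothesis sc2p : strongly_convex 2 mu2 f (min_ball l1 l2 v).
Hypothesis sc2m : strongly_convex 2 mu2 f (min_ball l1 l2 (- v)).
Context d (T : measurableType d) (P : probability T R).
Context (X : nat -> T -> 'cV[R]_n) (J : nat -> T -> 'I_n) (x0 : 'cV[R]_n).
Hypothesis run : scd_grad_ls P t f X J.
Hypothesis X0 : forall w, X 0%N w = x0.
Hypothesis x0_basin : basin A l1 l2 v x0.
Local Notation c := (descent_rate A l1 l2 t muq).

Lemma run_nonincreasing l w : f (X l.+1 w) <= f (X l w).
Proof.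
have [a amin ->] := scd_line_search run l w.
by have := amin 0; rewrite scale0r addr0.
Qed.

Lemma run_basin l w : basin A l1 l2 v (X l w).
Proof.
elim: l => [|l IH]; first by rewrite X0.
exact: basin_sublevel sc2p _ _ IH (run_nonincreasing l w).
Qed.

Lemma run_excess_le l w : F (X l w) <= F x0.
Proof.
elim: l => [|l IH]; first by rewrite X0.
apply: le_trans IH.
by have := run_nonincreasing l w; rewrite !(objectiveE A l1) lerD2l.
Qed.

Let decrease l w j := gradient f (X l w) j 0 ^+ 2 / (2 * L).

Lemma decrease_ge0 l w j : 0 <= decrease l w j.
Proof.
by rewrite /decrease divr_ge0 ?sqr_ge0// mulr_ge0// ltW// smoothness_gt0.
Qed.

(** An exact line search does at least as well as the step provided by
    [basin_descent]. *)
Lemma run_step l w : F (X l.+1 w) + decrease l w (J l w) <= F (X l w).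
Proof.
have [a amin ->] := scd_line_search run l w.
have [b Fb] := basin_descent Asym rayleigh l1_gt0 l2_lt Av v1 sc2p
  (J l w) (run_basin l w).
rewrite -lerBrDr; apply: le_trans _ Fb.
by have := amin b; rewrite !(objectiveE A l1) lerD2l.
Qed.

Let positive_weight l := [set w | exists i, coord_weight t f (X l w) i != 0].

Lemma positive_weightE l w :
  positive_weight l w <-> \sum_j coord_weight t f (X l w) j != 0.
Proof.
have w0 j : true -> 0 <= coord_weight t f (X l w) j by move=> _; exact: powR_ge0.
rewrite psumr_neq0//; split=> [[i wi]|/hasP[i _ /= wi]].
  by apply/hasP; exists i => /=; [exact: mem_index_enum|rewrite lt_def wi w0].
by exists i; rewrite gt_eqF.
Qed.

Lemma measurable_run l i : measurable_fun setT (fun w => X l w i 0).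
Proof. exact: scd_measurable_iterate run l i. Qed.

Lemma measurable_run_excess l : measurable_fun setT (fun w => F (X l w)).
Proof. by apply: measurable_excess => i; exact: measurable_run. Qed.

Local Notation HT l := (g_sigma_algebraType (history_generators X J l)).

Lemma history_measurable l : <<s history_generators X J l >> `<=` measurable.
Proof.
apply: smallest_sub; first exact: sigma_algebra_measurable.
move=> E [[k [i [B [_ mB ->]]]]|[k [j [_ ->]]]]; last exact: scd_measurable_coord run k j.
by rewrite -[X in measurable X]setTI; apply: measurable_run.
Qed.

Lemma history_measurable_run l i :
  measurable_fun setT ((fun w => X l w i 0) : HT l -> R).
Proof.
move=> _ B mB; rewrite setTI; apply: sub_sigma_algebra; left.
by exists l, i, B.
Qed.

Lemma history_positive_weight l : <<s history_generators X J l >> (positive_weight l).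
Proof.
have mW : measurable_fun setT
    ((fun w => \sum_j coord_weight t f (X l w) j) : HT l -> R).
  apply: measurable_sum => j; apply: (@measurable_coord_weight _ (HT l)) => // i.
  exact: history_measurable_run.
have := mW measurableT (~` [set 0]) (measurableC (measurable_set1 0)).
rewrite setTI; congr (<<s _ >> _); apply/seteqP; split=> w /=.
  by move=> /eqP/positive_weightE.
by move=> /positive_weightE/eqP.
Qed.

Lemma integral_decrease l j :
  (\int[P]_(w in positive_weight l `&` [set w | J l w = j]) (decrease l w j)%:E
   = \int[P]_(w in positive_weight l)
       (decrease l w j * coord_prob t f (X l w) j)%:E)%E.
Proof.
apply: (integral_sample (@history_measurable l)).
- exact: scd_measurable_coord run l j.
- exact: history_positive_weight.
- by move=> w; rewrite divr_ge0 ?powR_ge0// sumr_ge0// => i _; exact: powR_ge0.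
- by apply: measurable_coord_prob => // i; exact: measurable_run.
- by move=> E HE EP; exact: scd_sample run l j E HE EP.
- by move=> w; exact: decrease_ge0.
- apply: measurable_funM => //; apply: measurable_funX.
  by apply: (@measurable_gradient _ (HT l)) => // i; exact: history_measurable_run.
Qed.

(** Split the decrease according to the sampled coordinate j. On the event where
    the weights do not all vanish, [integral_decrease] replaces the indicator of
    J_l = j by its conditional probability, and [mean_decrease] applies for
    every outcome; outside this event F (X l) is zero. *)
Lemma integral_step l :
  (\int[P]_w (F (X l.+1 w))%:E + c%:E * \int[P]_w (F (X l w))%:E
     <= \int[P]_w (F (X l w))%:E)%E.
Proof.
have c0 : 0 <= c by apply/ltW/(descent_rate_gt0 _ _ _ scqp).
have F0 x : (0 <= (F x)%:E)%E by rewrite lee_fin excess_ge0.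
have mE : measurable (positive_weight l).
  exact: history_measurable (@history_positive_weight l).
have mJ j : measurable [set w | J l w = j] by exact: scd_measurable_coord run l j.
have mEJ j : measurable (positive_weight l `&` [set w | J l w = j]) by exact: measurableI.
have md j : measurable_fun setT (fun w => decrease l w j).
  apply: measurable_funM => //; apply: measurable_funX.
  by apply: measurable_gradient => // i; exact: measurable_run.
have mp j : measurable_fun setT (fun w => coord_prob t f (X l w) j).
  by apply: measurable_coord_prob => // i; exact: measurable_run.
have p0 w j : 0 <= coord_prob t f (X l w) j.
  by rewrite divr_ge0 ?powR_ge0// sumr_ge0// => i _; exact: powR_ge0.
pose sampled j :=
  (fun w => (decrease l w j)%:E) \_ (positive_weight l `&` [set w | J l w = j]).
have msampled j : measurable_fun setT (sampled j).
  apply/(measurable_restrictT _ (mEJ j)).1; apply/measurable_EFinP.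
  exact: measurable_funTS.
have sampled0 j w : (0 <= sampled j w)%E.
  by apply: erestrict_ge0 => x _; rewrite lee_fin decrease_ge0.
have mean : (c%:E * \int[P]_w (F (X l w))%:E <= \int[P]_w \sum_j sampled j w)%E.
  rewrite ge0_integral_sum//.
  under eq_bigr do rewrite -integral_mkcond integral_decrease.
  rewrite -ge0_integral_sum//; last 2 first.
  - move=> j; apply/measurable_EFinP; apply: measurable_funTS.
    exact: measurable_funM.
  - by move=> j w _; rewrite lee_fin mulr_ge0// decrease_ge0.
  rewrite -ge0_integralZl_EFin//; last first.
    by apply/measurable_EFinP; exact: measurable_run_excess.
  rewrite [leRHS]integral_mkcond; apply: ge0_le_integral_nonmeasurable => w.
    by rewrite mule_ge0.
  rewrite patchE; case: ifPn => [/set_mem/positive_weightE W|].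
    rewrite sumEFin -EFinM lee_fin.
    apply: (mean_decrease l1_gt0 l2_lt n_gt0 t_ge0 Av v1 scqp scqm) => //.
    exact: run_basin.
  rewrite notin_setE => nW.
  have W : \sum_j coord_weight t f (X l w) j = 0.
    by apply/eqP; apply: contra_notT nW => /positive_weightE.
  rewrite (no_weight_excess0 rayleigh l1_gt0 l2_lt t_ge0 Av v1 scqp scqm _ W).
    by rewrite mule0.
  exact: run_basin.
apply: (le_trans (leeD2l _ mean)).
rewrite -ge0_integralD//; last 3 first.
- by apply/measurable_EFinP; exact: measurable_run_excess.
- by move=> w _; exact: sume_ge0.
- by apply: emeasurable_sum.
apply: ge0_le_integral_nonmeasurable => w; first by rewrite adde_ge0// sume_ge0.
have [Ew|Ew] := pselect (positive_weight l w); last first.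
  rewrite big1 ?adde0 => [|j _].
    by rewrite lee_fin; have := run_step l w; have := decrease_ge0 l w (J l w); lra.
  by rewrite /sampled patchE memNset// => -[].
rewrite (bigD1 (J l w))//= big1 ?adde0 => [|j jJ]; last first.
  rewrite /sampled patchE memNset// => -[_ /= Jj].
  by move: jJ; rewrite -Jj eqxx.
rewrite /sampled patchE mem_set// -EFinD lee_fin; exact: run_step.
Qed.

Lemma integral_excess_finite l :
  exists2 r : R, 0 <= r & (\int[P]_w (F (X l w))%:E = r%:E)%E.
Proof.
have F0 w : (0 <= (F (X l w))%:E)%E by rewrite lee_fin excess_ge0.
have I0 : (0 <= \int[P]_w (F (X l w))%:E)%E by exact: integral_ge0.
have I1 : (\int[P]_w (F (X l w))%:E <= (F x0)%:E)%E.
  have -> : (F x0)%:E = (\int[P]_w (F x0)%:E)%E.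
    by rewrite integral_cst//= probability_setT mule1.
  by apply: ge0_le_integral_nonmeasurable => // w; rewrite lee_fin run_excess_le.
have fin : (\int[P]_w (F (X l w))%:E \is a fin_num)%E.
  by rewrite ge0_fin_numE// (le_lt_trans I1)// ltry.
exists (fine (\int[P]_w (F (X l w))%:E)%E); first exact: fine_ge0.
by rewrite fineK.
Qed.

Lemma integral_excess_le l :
  (\int[P]_w (F (X l w))%:E <= ((1 - c) ^+ l * F x0)%:E)%E.
Proof.
have [u uP] := choice (fun l => let: ex_intro2 r r0 rE := integral_excess_finite l in
  ex_intro (fun r => 0 <= r /\ (\int[P]_w (F (X l w))%:E = r%:E)%E) r (conj r0 rE)).
have u0 : u 0%N = F x0.
  apply: EFin_inj; rewrite -(uP 0%N).2.
  by under eq_integral do rewrite X0; rewrite integral_cst//= probability_setT mule1.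
rewrite (uP l).2 lee_fin -u0; apply: geometric_decay => k; first exact: (uP k).1.
have := integral_step k; rewrite !(uP _).2 -EFinM -EFinD lee_fin; lra.
Qed.

Lemma expected_objective_gap l :
  ('E_P[fun w => f (X l w)] - (min_value f)%:E
     <= ((1 - c) ^+ l * (f x0 - min_value f))%:E)%E.
Proof.
rewrite unlock (excessE rayleigh l1_gt0 Av v1).
have [r _ rE] := integral_excess_finite l.
have -> : (\int[P]_w (f (X l w))%:E = (min_value f)%:E + \int[P]_w (F (X l w))%:E)%E.
  under eq_integral => w _.
    have -> : f (X l w) = min_value f + F (X l w).
      by rewrite -(excessE rayleigh l1_gt0 Av v1) subrKC.
    rewrite EFinD; over.
  rewrite integralD//=.
  - by rewrite integral_cst//= probability_setT mule1.
  - exact: finite_measure_integrable_cst.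
  - apply/integrableP; split.
      by apply/measurable_EFinP; exact: measurable_run_excess.
    under eq_integral do rewrite gee0_abs ?lee_fin ?excess_ge0//.
    by rewrite rE ltry.
by have := integral_excess_le l; rewrite rE -EFinD !lee_fin [_ + r]addrC addrK.
Qed.

Lemma expected_square_distance l :
  ('E_P[fun w => (dist (X l w) (minimizers f) ^+ 2)%R]
     <= (2 / mu2 * (1 - c) ^+ l * (f x0 - min_value f))%:E)%E.
Proof.
have mu20 : 0 < mu2 by case: sc2p.
rewrite unlock (excessE rayleigh l1_gt0 Av v1).
apply: (@le_trans _ _ (\int[P]_w ((2 / mu2)%:E * (F (X l w))%:E))%E).
  apply: ge0_le_integral_nonmeasurable => w; first by rewrite lee_fin sqr_ge0.
  rewrite -EFinM lee_fin.
  apply: (basin_distance Asym rayleigh l1_gt0 l2_lt Av v1 sc2p sc2m).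
  exact: run_basin.
rewrite ge0_integralZl_EFin//.
- have [r _ rE] := integral_excess_finite l; have := integral_excess_le l.
  rewrite rE -EFinM !lee_fin -[X in _ -> _ <= X]mulrA.
  by apply: ler_wpM2l; rewrite divr_ge0// ltW.
- by move=> w _; rewrite lee_fin excess_ge0.
- by apply/measurable_EFinP; exact: measurable_run_excess.
- by rewrite divr_ge0// ltW.
Qed.

End Run.

Theorem theorem5p7 (R : realType) (n : nat) (A : 'M[R]_n) (lam : seq R)
    (v1 : 'cV[R]_n) (t muq mu2 : R)
    (d : measure_display) (T : measurableType d) (P : probability T R)
    (X : nat -> T -> 'cV[R]_n) (J : nat -> T -> 'I_n) (x0 : 'cV[R]_n)
    (n_ge2 : (2 <= n)%N)
    (A_sym : A^T = A)
    (lam_eigenvalues : char_poly A = \prod_(a <- lam) ('X - a%:P))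
    (lam_sorted : sorted >=%R lam)
    (lam_gap : lam`_1 < lam`_0)
    (lam_pos : 0 < lam`_0)
    (v1_eigenvector : A *m v1 = lam`_0 *: v1)
    (v1_unit : enorm v1 = 1)
    (t_ge0 : 0 <= t) :
  let f := objective A in
  let fstar := min_value f in
  let Xstar := minimizers f in
  let q := (t + 2) / (t + 1) in
  let Bplus := min_ball lam`_0 lam`_1 v1 in
  let Bminus := min_ball lam`_0 lam`_1 (- v1) in
  let L := 12 * lam`_0 + 2 * gap lam`_0 lam`_1
           + 4 * \big[Num.max/0]_i `|A i i| in
  let rate := 1 - muq / (L * n%:R `^ (2 - 2 / q)) in
  strongly_convex q muq f Bplus -> strongly_convex q muq f Bminus ->
  strongly_convex 2 mu2 f Bplus -> strongly_convex 2 mu2 f Bminus ->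
  scd_grad_ls P t f X J ->
  (forall w, X 0%N w = x0) ->
  (boundary_sublevel f Bplus `|` boundary_sublevel f Bminus) x0 ->
  forall l : nat,
    ('E_P[fun w => f (X l w)] - fstar%:E <= (rate ^+ l * (f x0 - fstar))%:E)%E
    /\
    ('E_P[fun w => (dist (X l w) Xstar ^+ 2)%R]
       <= (2 / mu2 * rate ^+ l * (f x0 - fstar))%:E)%E.
Proof.
move=> f fstar Xstar q Bplus Bminus L rate scqp scqm sc2p sc2m run X0 x0D l.
have rayleigh := rayleigh_le A_sym lam_eigenvalues lam_sorted.
have n_gt0 : (0 < n)%N by exact: ltn_trans n_ge2.
have basin0 : basin A lam`_0 lam`_1 v1 x0.
  by rewrite -(boundary_sublevelE A lam_pos lam_gap v1).
split.
  exact: (expected_objective_gap A_sym rayleigh lam_pos lam_gap n_gt0 t_ge0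
    v1_eigenvector v1_unit scqp scqm sc2p run X0 basin0).
exact: (expected_square_distance A_sym rayleigh lam_pos lam_gap n_gt0 t_ge0
  v1_eigenvector v1_unit scqp scqm sc2p sc2m run X0 basin0).
Qed.
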